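(* Let $\boldsymbol r_1(s),\boldsymbol r_2(s)$ be two smooth regular curves in the plane $P_2$, parametrized by arc length $s$ on intervals containing $0$ in their interior, each without self-intersection, and both contained in the half plane $\{x_1>0\}$. Suppose they intersect transversely at $p=\boldsymbol r_1(0)=\boldsymbol r_2(0)$ and that $p$ is their only intersection point. Let $\boldsymbol T_i=\boldsymbol r_i'/\|\boldsymbol r_i'\|$ and let $\boldsymbol n_i$ be the associated unit normal field of $\boldsymbol r_i$ in $P_2$; assume $\boldsymbol T_2(0)\cdot\boldsymbol n_1(0)>0$. Let $R_i$ be the surface in $\mathbb{R}^3$ obtained by rotating $\boldsymbol r_i$ around the $x_3$-axis, with the normal field generated by $\boldsymbol n_i$, and let $H_i(s)$ be the mean curvature of $R_i$ at $\boldsymbol r_i(s)$ with respect to this normal. Then for every $\delta>0$ there exist a (small) $\epsilon>0$ and a curve $\boldsymbol r$ such that: 1. $\boldsymbol r(s)$ is a smooth regular parametrized curve in $P_2$ with $\boldsymbol r(s)=\boldsymbol r_1(s)$ for $s\le-\epsilon$ and $\boldsymbol r(s)=\boldsymbol r_2(s)$ for $s\ge\epsilon$ (the parameter $s$ is not required to be arc length for $|s|\le\epsilon$). 2. The part of $\boldsymbol r$ with $|s|\le\epsilon$ does not intersect itself, does not intersect the other parts of $\boldsymbol r$ in $B(p,\delta)$, and satisfies $d(\boldsymbol r(s),p)<\delta$ for $|s|\le \epsilon$. 3. Let $\boldsymbol T=\boldsymbol r'/\|\boldsymbol r'\|$, let $\boldsymbol n$ be its associated unit normal field (which coincides with $\boldsymbol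 n_1$ or $\boldsymbol n_2$ for $|s|>\epsilon$), let $R$ be the surface of revolution of $\boldsymbol r$ around the $x_3$-axis with the normal generated by $\boldsymbol n$, and let $H(s)$ be the mean curvature of $R$ at $\boldsymbol r(s)$. Then $H(s)\ge H_1(s)$ for $-\epsilon<s<0$ and $H(s)\ge H_2(s)$ for $0<s<\epsilon$.
   Context: $P_2=\{(x_1,x_2,x_3)\in\mathbb{R}^3: x_2=0\}$ with coordinates $(x_3,x_1)$, $x_3$ being the abscissa and $x_1$ the ordinate. For a unit tangent field $\boldsymbol T=(u,v)$ in these coordinates, the associated unit normal is $\boldsymbol n=(v,-u)$ (clockwise rotation by $90^\circ$), so that $\boldsymbol T_2(0)\cdot\boldsymbol n_1(0)>0$ means that $\boldsymbol r_1$ turns right (clockwise) to become $\boldsymbol r_2$ at $s=0$. The mean curvature is the average of the two principal curvatures, with sign such that the unit sphere with inward normal has mean curvature $1$. $B(p,\delta)$ is the open disk of radius $\delta$ about $p$ in $P_2$ and $d$ is Euclidean distance.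
   Formalization: ''Without self-intersection'' is taken as embedded: injective with continuous inverse on the image (automatic on compact intervals); with mere injectivity on non-compact intervals, an end of r_1 could accumulate at p inside the corner being cut, making item 2 fail. *)

(* Defs.v *)
From Stdlib Require Import Reals Lra.
From Coquelicot Require Import Coquelicot.
Open Scope R_scope.

(* Points and vectors of the plane P_2 are pairs (x3, x1): abscissa first,
   then the ordinate x1, which is the distance to the axis of rotation. *)
Definition plane : Type := (R * R)%type.
Definition x3 (q : plane) : R := fst q.
Definition x1 (q : plane) : R := snd q.

Definition dot (v w : plane) : R := x3 v * x3 w + x1 v * x1 w.
Definition det2 (v w : plane) : R := x3 v * x1 w - x1 v * x3 w.
Definition dist2 (p q : plane) : R := dist_euc (x3 p) (x1 p) (x3 q) (x1 q).

Definition is_interval (D : R -> Prop) : Prop :=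
  forall a b t, D a -> D b -> a <= t <= b -> D t.

(* A curve on an interval D is a total function of which only the values on D
   matter.  [Derive] is meaningful for it at the interior points of D, that is
   at those s with [locally s D]. *)
Definition velocity (r : R -> plane) (s : R) : plane :=
  (Derive (fun t => x3 (r t)) s, Derive (fun t => x1 (r t)) s).
Definition speed (r : R -> plane) (s : R) : R :=
  sqrt (dot (velocity r s) (velocity r s)).
Definition tangent (r : R -> plane) (s : R) : plane :=
  (x3 (velocity r s) / speed r s, x1 (velocity r s) / speed r s).
(* (u, v) |-> (v, -u), the clockwise rotation by a right angle *)
Definition normal (r : R -> plane) (s : R) : plane :=
  (x1 (tangent r s), - x3 (tangent r s)).

Definition smooth_at (g : R -> plane) (t : R) : Prop :=
  forall n : nat, ex_derive_n (fun u => x3 (g u)) n t /\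
                  ex_derive_n (fun u => x1 (g u)) n t.

(* D may contain its endpoints, so smoothness on D is the existence of smooth
   local extensions; these determine the velocity at an endpoint. *)
Definition smooth_regular (D : R -> Prop) (r : R -> plane) : Prop :=
  forall s, D s -> exists g : R -> plane,
    locally s (fun t => smooth_at g t /\ (D t -> r t = g t)) /\
    velocity g s <> (0, 0).

(* At an endpoint of D unit speed follows by continuity. *)
Definition unit_speed (D : R -> Prop) (r : R -> plane) : Prop :=
  forall s, locally s D -> speed r s = 1.

Definition injective_on (D : R -> Prop) (r : R -> plane) : Prop :=
  forall s t, D s -> D t -> r s = r t -> s = t.

(* Absence of self-intersections, in the sense of an embedded curve: an end of
   a non-compact curve does not accumulate at a point of the curve either, as
   in a figure 6 whose end point is left out.  On a compact interval
   injectivity suffices, see [injective_simple_curve]. *)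
Definition simple_curve (D : R -> Prop) (r : R -> plane) : Prop :=
  injective_on D r /\
  forall s, D s -> forall e, 0 < e -> exists d, 0 < d /\
    forall t, D t -> dist2 (r s) (r t) < d -> Rabs (t - s) < e.

Definition space : Type := (R * R * R)%type.
Definition coord1 (w : space) : R := fst (fst w).
Definition coord2 (w : space) : R := snd (fst w).
Definition coord3 (w : space) : R := snd w.
Definition dot3 (v w : space) : R :=
  coord1 v * coord1 w + coord2 v * coord2 w + coord3 v * coord3 w.

Definition revolution (r : R -> plane) (s a : R) : space :=
  (x1 (r s) * cos a, x1 (r s) * sin a, x3 (r s)).
Definition revolution_normal (r : R -> plane) : R -> R -> space :=
  revolution (normal r).

Definition Derive3 (w : R -> space) (t : R) : space :=
  (Derive (fun u => coord1 (w u)) t, Derive (fun u => coord2 (w u)) t,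
   Derive (fun u => coord3 (w u)) t).
Definition d_s (X : R -> R -> space) (s a : R) : space :=
  Derive3 (fun t => X t a) s.
Definition d_a (X : R -> R -> space) (s a : R) : space :=
  Derive3 (fun t => X s t) a.

(* The principal curvatures are the eigenvalues, with multiplicity, of the
   shape operator of the parametrized surface X with unit normal N, i.e. the
   roots of det (II - k I) = 0 for the fundamental forms I and II.  The sign
   II = <D^2 X, N> makes the unit sphere with inward normal have k1 = k2 = 1. *)
Definition principal_curvatures (X N : R -> R -> space) (s a k1 k2 : R) : Prop :=
  let E := dot3 (d_s X s a) (d_s X s a) in
  let F := dot3 (d_s X s a) (d_a X s a) in
  let G := dot3 (d_a X s a) (d_a X s a) in
  let L := dot3 (d_s (d_s X) s a) (N s a) in
  let M := dot3 (d_s (d_a X) s a) (N s a) in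
  let P := dot3 (d_a (d_a X) s a) (N s a) in
  E * G - F ^ 2 <> 0 /\
  forall k, (L - k * E) * (P - k * G) - (M - k * F) ^ 2
            = (E * G - F ^ 2) * ((k - k1) * (k - k2)).

Definition is_mean_curvature (X N : R -> R -> space) (s a h : R) : Prop :=
  exists k1 k2, principal_curvatures X N s a k1 k2 /\ h = (k1 + k2) / 2.

(* The point r s of P_2 is revolution r s 0. *)
Definition is_revolution_mean_curvature (r : R -> plane) (s h : R) : Prop :=
  is_mean_curvature (revolution r) (revolution_normal r) s 0 h.

(* The parameter interval of a curve following r1 before s = 0 and r2 after. *)
Definition joined (D1 D2 : R -> Prop) (s : R) : Prop :=
  (s <= 0 /\ D1 s) \/ (0 <= s /\ D2 s).

Lemma dist2_eq0 (p q : plane) : dist2 p q = 0 -> p = q.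
Proof.
  destruct p as [a b], q as [c d]. unfold dist2, dist_euc, x3, x1; simpl.
  intro h. apply sqrt_eq_0 in h.
  - apply Rplus_sqr_eq_0 in h. destruct h. f_equal; lra.
  - apply Rplus_le_le_0_compat; apply Rle_0_sqr.
Qed.

Lemma dist2_ge0 (p q : plane) : 0 <= dist2 p q.
Proof. apply sqrt_pos. Qed.

Lemma injective_simple_curve (a b : R) (r : R -> plane) :
  smooth_regular (fun s => a <= s <= b) r ->
  injective_on (fun s => a <= s <= b) r ->
  simple_curve (fun s => a <= s <= b) r.
Proof.
  intros hr hi. split; [exact hi|]. intros s hs e he.
  set (cl := fun t => Rmax a (Rmin b t)).
  assert (hcl : forall t, a <= b -> a <= cl t <= b).
  { intros t hab. unfold cl, Rmax, Rmin.
    destruct (Rle_dec b t); destruct (Rle_dec a _); lra. }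
  assert (hid : forall t, a <= t <= b -> cl t = t).
  { intros t ht. unfold cl. rewrite Rmin_right, Rmax_right; lra. }
  assert (hlip : forall t u, Rabs (cl t - cl u) <= Rabs (t - u)).
  { intros t u. unfold cl, Rmax, Rmin.
    destruct (Rle_dec b t); destruct (Rle_dec b u);
    repeat destruct (Rle_dec a _); unfold Rabs; repeat destruct Rcase_abs; lra. }
  assert (hab : a <= b) by lra.
  set (f := fun t => dist2 (r s) (r (cl t))).
  assert (hf : forall t, continuity_pt f t).
  { intro t. destruct (hr (cl t) (hcl t hab)) as [g [hg _]].
    assert (h0 : smooth_at g (cl t)) by (apply locally_singleton in hg; tauto).
    destruct (h0 1%nat) as [h3 h1]. simpl in h3, h1.
    assert (hcc : continuous cl t).
    { apply continuity_pt_filterlim. intros eps heps. exists eps. split; [exact heps|].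
      intros u [_ hu]. eapply Rle_lt_trans; [apply hlip|exact hu]. }
    apply continuity_pt_filterlim.
    apply (continuous_ext_loc _ (fun u => dist2 (r s) (g (cl u)))).
    - specialize (hcc _ hg). unfold filtermap in hcc.
      revert hcc. apply filter_imp. intros u [_ hu]. unfold f.
      rewrite (hu (hcl u hab)). reflexivity.
    - unfold dist2, dist_euc, Rsqr.
      assert (k3 : continuous (fun u => x3 (g (cl u))) t).
      { apply (continuous_comp cl (fun u => x3 (g u))); [exact hcc|].
        apply (ex_derive_continuous (K := R_AbsRing) (V := R_NormedModule)); exact h3. }
      assert (k1 : continuous (fun u => x1 (g (cl u))) t).
      { apply (continuous_comp cl (fun u => x1 (g u))); [exact hcc|].
        apply (ex_derive_continuous (K := R_AbsRing) (V := R_NormedModule)); exact h1. }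
      apply (continuous_comp _ sqrt); [|apply continuous_sqrt].
      assert (d3 : continuous (fun u => x3 (r s) - x3 (g (cl u))) t).
      { apply (continuous_minus (fun _ => x3 (r s))); [|exact k3].
        apply continuous_const. }
      assert (d1 : continuous (fun u => x1 (r s) - x1 (g (cl u))) t).
      { apply (continuous_minus (fun _ => x1 (r s))); [|exact k1].
        apply continuous_const. }
      apply (continuous_plus
               (fun u => (x3 (r s) - x3 (g (cl u))) * (x3 (r s) - x3 (g (cl u)))));
        apply (continuous_mult (K := R_AbsRing)); assumption. }
  assert (hmin : forall u v, a <= u -> v <= b -> (s < u \/ v < s) ->
            exists d, 0 < d /\ forall t, u <= t <= v -> d <= dist2 (r s) (r t)).
  { intros u v hu hv huv. destruct (Rle_dec u v) as [h|h].
    - destruct (continuity_ab_min f u v h (fun t _ => hf t)) as [m [hm1 hm2]].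
      exists (f m). split.
      + destruct (Rle_lt_or_eq_dec 0 (f m) (dist2_ge0 _ _)) as [q|q]; [exact q|].
        exfalso. symmetry in q. apply dist2_eq0 in q.
        rewrite (hid m ltac:(lra)) in q.
        apply hi in q; lra.
      + intros t ht. generalize (hm1 t ht). unfold f at 2.
        rewrite (hid t ltac:(lra)). tauto.
    - exists 1. split; [lra|]. intros; lra. }
  destruct (hmin a (s - e)) as [d1 [hd1 q1]]; try lra.
  destruct (hmin (s + e) b) as [d2 [hd2 q2]]; try lra.
  exists (Rmin d1 d2). split; [apply Rmin_glb_lt; assumption|].
  intros t ht hd.
  generalize (Rmin_l d1 d2), (Rmin_r d1 d2); intros m1 m2.
  destruct (Rle_dec t (s - e)) as [h|h]; [generalize (q1 t ltac:(lra)); lra|].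
  destruct (Rle_dec (s + e) t) as [h'|h']; [generalize (q2 t ltac:(lra)); lra|].
  apply Rabs_def1; lra.
Qed.

(* Main.v *)
Require Import Defs.
From Stdlib Require Import Reals Lra Lia Psatz FunctionalExtensionality.
From Coquelicot Require Import Coquelicot.
Open Scope R_scope.

(** Write T1, T2 for the tangents at p and V = T2 - T1.  If psi is a smooth convex function
    with psi (t) = 0 for t <= -1 and psi (t) = t for t >= 1, then for two half lines the curve
    s T1 + eps psi (s / eps) V rounds the corner by turning right all the way.  For the
    given curves the same is done with an explicit formula,
      r = r1 + a (r2 - r1 - s V) + eps psi (s / eps) V,   a (s) = psi' (2 s / eps),
    which equals r1 for s <= - eps and r2 for s >= eps, so that no matching of end
    conditions is needed ([blend], [blend_left], [blend_right]).

    Since r2 - r1 - s V = O (s^2), the velocity of r is T1 + psi' V + O (eps), a vector close to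
    the segment from T1 to T2 ([between_directions]).  As the turning angle is less than
    pi, r is regular and moves monotonically in the direction T1 + T2, hence is injective.
    Parts of r1 and r2 with a small parameter do not come back for the same reason, and the
    remaining ones stay away from p because these curves are simple.

    For the mean curvature put u = psi'' (s / eps).  For s <= 0, r and r1 agree up to O (u) to
    first order, and r'' - r1'' = (u / eps) V + O (u); for s >= 0 the same holds with r2
    ([blend_estimates]).  This rests on psi <= psi' <= psi'' on ]-oo, 0], which holds when
    psi'' is an even bump that increases up to 0, and on the fact that the switch a varies
    only where u is bounded below.  Turning right means that V points to the side of the
    normal, so the mean curvature of r exceeds that of the given curve by at least
    u (c / eps - C), with c > 0 and C independent of eps ([mean_curvature_increases]).  This
    is nonnegative for small eps, also at the ends, where u tends to 0. *)

(** * Smooth functions of one variable *)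

Definition smooth_on (U : R -> Prop) (f : R -> R) : Prop :=
  forall n t, U t -> ex_derive_n f n t.

Definition everywhere (t : R) : Prop := True.

Lemma open_everywhere : open everywhere.
Proof. intros t _. exists (mkposreal 1 Rlt_0_1). intros; exact I. Qed.

Lemma ex_derive_n_S (f g : R -> R) (n : nat) (t : R) :
  locally t (fun u => is_derive f u (g u)) ->
  ex_derive_n g n t -> ex_derive_n f (S n) t.
Proof.
  intros hf hg. destruct n as [|n].
  - simpl. exists (g t). exact (locally_singleton _ _ hf).
  - simpl in hg. apply (ex_derive_ext_loc (Derive_n g n)); [|exact hg].
    apply locally_locally in hf. revert hf. apply filter_imp. intros u hu.
    replace (S n) with (n + 1)%nat by lia.
    rewrite <- Derive_n_comp. apply Derive_n_ext_loc. revert hu.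
    apply filter_imp. intros v hv. simpl. symmetry. apply is_derive_unique, hv.
Qed.

Lemma smooth_on_is_derive (U : R -> Prop) (f : R -> R) (t : R) :
  smooth_on U f -> U t -> is_derive f t (Derive f t).
Proof. intros hf ht. apply Derive_correct. exact (hf 1%nat t ht). Qed.

Lemma smooth_on_Derive (U : R -> Prop) (f : R -> R) : smooth_on U f -> smooth_on U (Derive f).
Proof.
  intros hf n t ht. destruct n as [|n]; [exact I|].
  simpl. apply (ex_derive_ext (Derive_n f (S n))); [|exact (hf (S (S n)) t ht)].
  intro u. replace (S n) with (n + 1)%nat by lia.
  rewrite <- Derive_n_comp. reflexivity.
Qed.

Lemma smooth_on_primitive (U : R -> Prop) (openU : open U) (f g : R -> R) :
  (forall t, U t -> is_derive f t (g t)) -> smooth_on U g -> smooth_on U f.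
Proof.
  intros hf hg n t ht. destruct n as [|n]; [exact I|].
  apply (ex_derive_n_S f g); [|exact (hg n t ht)].
  apply (filter_imp U); [exact hf|exact (openU t ht)].
Qed.

Lemma smooth_on_const (U : R -> Prop) (c : R) : smooth_on U (fun _ => c).
Proof. intros n t _. apply ex_derive_n_const. Qed.

Lemma smooth_on_id (U : R -> Prop) (openU : open U) : smooth_on U (fun t => t).
Proof.
  apply (smooth_on_primitive U openU _ (fun _ => 1)); [|apply smooth_on_const].
  intros t _. apply (is_derive_id t).
Qed.

Lemma smooth_on_plus (U : R -> Prop) (openU : open U) (f g : R -> R) :
  smooth_on U f -> smooth_on U g -> smooth_on U (fun t => f t + g t).
Proof.
  intros hf hg n t ht. apply ex_derive_n_plus;
    apply (filter_imp U); try exact (openU t ht); intros u hu k _.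
  - apply hf, hu.
  - apply hg, hu.
Qed.

Lemma smooth_on_minus (U : R -> Prop) (openU : open U) (f g : R -> R) :
  smooth_on U f -> smooth_on U g -> smooth_on U (fun t => f t - g t).
Proof.
  intros hf hg. apply (smooth_on_plus U openU f (fun t => - g t) hf).
  intros n t ht. apply ex_derive_n_opp, hg, ht.
Qed.

Lemma smooth_on_mult (U : R -> Prop) (openU : open U) (f g : R -> R) :
  smooth_on U f -> smooth_on U g -> smooth_on U (fun t => f t * g t).
Proof.
  intros hf hg n. revert f g hf hg.
  induction n as [n IH] using (well_founded_induction Wf_nat.lt_wf).
  intros f g hf hg t ht. destruct n as [|n]; [exact I|].
  apply (ex_derive_n_S _ (fun u => Derive f u * g u + f u * Derive g u)).
  - apply (filter_imp U); [|exact (openU t ht)]. intros u hu.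
    apply (is_derive_mult f g u); try (apply (smooth_on_is_derive U); assumption).
    intros; apply Rmult_comm.
  - apply ex_derive_n_plus; apply (filter_imp U); try exact (openU t ht);
      intros u hu k hk; apply IH; try lia; try assumption;
      apply smooth_on_Derive; assumption.
Qed.

Lemma smooth_on_affine (U : R -> Prop) (f : R -> R) (a b : R) :
  smooth_on everywhere f -> smooth_on U (fun t => f (a * t + b)).
Proof.
  intros hf n t _.
  apply (ex_derive_n_comp_scal (fun z => f (z + b)) a).
  apply filter_forall. intros z k _. apply ex_derive_n_comp_trans. apply hf, I.
Qed.

Lemma smooth_on_ext (U : R -> Prop) (openU : open U) (f g : R -> R) :
  (forall t, U t -> f t = g t) -> smooth_on U f -> smooth_on U g.
Proof.
  intros hfg hf n t ht. apply (ex_derive_n_ext_loc f); [|apply hf, ht].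
  apply (filter_imp U); [exact hfg|exact (openU t ht)].
Qed.

(** * A flat function and a bump *)

(** The functions t^(-n) exp (-1/t), extended by 0, are all needed because
    differentiating one of them gives a combination of the next two; smoothness of the
    n = 0 member comes from this closure. *)
Definition flat (n : nat) (t : R) : R :=
  if Rlt_dec 0 t then exp (- / t) * (/ t) ^ n else 0.

(** Proved by induction from 1 + y <= exp y, splitting exp y = exp (y/2) * exp (y/2). *)
Lemma pow_le_exp (k : nat) : exists C, 0 < C /\ forall y, 0 <= y -> y ^ k <= C * exp y.
Proof.
  induction k as [|k [C [hC IH]]].
  - exists 1. split; [lra|]. intros y hy. simpl. generalize (exp_ineq1_le y). lra.
  - exists (2 ^ S k * C). split; [apply Rmult_lt_0_compat; [apply pow_lt; lra|lra]|].
    intros y hy.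
    replace (y ^ S k) with (2 ^ S k * ((y / 2) * (y / 2) ^ k)).
    2: { change ((y / 2) * (y / 2) ^ k) with ((y / 2) ^ S k).
         rewrite <- Rpow_mult_distr. f_equal. field. }
    rewrite Rmult_assoc. apply Rmult_le_compat_l; [apply pow_le; lra|].
    replace (exp y) with (exp (y / 2) * exp (y / 2)) by (rewrite <- exp_plus; f_equal; field).
    generalize (IH (y / 2) ltac:(lra)), (exp_ineq1_le (y / 2)); intros h1 h2.
    assert (0 <= (y / 2) ^ k) by (apply pow_le; lra).
    apply Rle_trans with (exp (y / 2) * (C * exp (y / 2))); [|lra].
    apply Rmult_le_compat; lra.
Qed.

(** The quadratic bound is what gives the derivative 0 at the origin. *)
Lemma flat_quadratic (n : nat) : exists C, 0 < C /\ forall t, Rabs (flat n t) <= C * t ^ 2.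
Proof.
  destruct (pow_le_exp (n + 2)) as [C [hC h]]. exists C. split; [exact hC|].
  intro t. unfold flat. destruct (Rlt_dec 0 t) as [ht|ht].
  - assert (hi : 0 < / t) by (apply Rinv_0_lt_compat; lra).
    specialize (h (/ t) ltac:(lra)). rewrite pow_add in h.
    assert (he := exp_pos (- / t)). assert (hp : 0 <= (/ t) ^ n) by (apply pow_le; lra).
    rewrite Rabs_pos_eq by (apply Rmult_le_pos; lra).
    assert (e1 : exp (- / t) * exp (/ t) = 1).
    { rewrite <- exp_plus, <- exp_0. f_equal. ring. }
    assert (e2 : (/ t) ^ 2 * t ^ 2 = 1) by (field; lra).
    assert (ht2 : 0 < t ^ 2) by (apply pow_lt; lra).
    apply (Rmult_le_compat_l (exp (- / t) * t ^ 2)) in h; [|apply Rmult_le_pos; lra].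
    replace (exp (- / t) * t ^ 2 * ((/ t) ^ n * (/ t) ^ 2))
      with (exp (- / t) * (/ t) ^ n * ((/ t) ^ 2 * t ^ 2)) in h by ring.
    replace (exp (- / t) * t ^ 2 * (C * exp (/ t)))
      with (C * t ^ 2 * (exp (- / t) * exp (/ t))) in h by ring.
    rewrite e1, e2 in h. lra.
  - rewrite Rabs_R0. apply Rmult_le_pos; [lra|]. apply pow2_ge_0.
Qed.

Lemma is_derive_flat (n : nat) (t : R) :
  is_derive (flat n) t (flat (n + 2) t - INR n * flat (n + 1) t).
Proof.
  destruct (total_order_T 0 t) as [[ht|ht]|ht].
  - apply (is_derive_ext_loc (fun u => exp (- / u) * (/ u) ^ n)).
    + apply (filter_imp (fun u => 0 < u)); [|apply (open_gt 0), ht].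
      intros u hu. unfold flat. destruct (Rlt_dec 0 u); [reflexivity|contradiction].
    + unfold flat. destruct (Rlt_dec 0 t); [|contradiction].
      auto_derive; [lra|].
      destruct n as [|n].
      * simpl. field. lra.
      * rewrite !pow_add. simpl pred. rewrite <- !tech_pow_Rmult. simpl. field. lra.
  - subst t. unfold flat at 2 3. destruct (Rlt_dec 0 0) as [h|_]; [lra|].
    replace (0 - INR n * 0) with 0 by ring.
    destruct (flat_quadratic n) as [C [hC h]].
    apply is_derive_Reals. intros e he.
    assert (hd : 0 < e / C) by (apply Rdiv_lt_0_compat; lra).
    exists (mkposreal _ hd). intros u hu0 hu. simpl in hu.
    rewrite Rplus_0_l, Rminus_0_r. unfold flat at 2. destruct (Rlt_dec 0 0) as [h'|_]; [lra|].
    rewrite Rminus_0_r. unfold Rdiv. rewrite Rabs_mult, Rabs_inv.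
    assert (hp : 0 < Rabs u) by (apply Rabs_pos_lt, hu0).
    apply Rle_lt_trans with (C * u ^ 2 * / Rabs u).
    + apply Rmult_le_compat_r; [apply Rlt_le, Rinv_0_lt_compat, hp|apply h].
    + rewrite <- pow2_abs. replace (C * Rabs u ^ 2 * / Rabs u) with (Rabs u * C) by (field; lra).
      apply (Rmult_lt_compat_r C) in hu; [|lra].
      replace (e / C * C) with e in hu by (field; lra). exact hu.
  - apply (is_derive_ext_loc (fun _ => 0)).
    + apply (filter_imp (fun u => u < 0)); [|apply (open_lt 0), ht].
      intros u hu. unfold flat. destruct (Rlt_dec 0 u); [lra|reflexivity].
    + unfold flat. destruct (Rlt_dec 0 t); [lra|].
      replace (0 - INR n * 0) with 0 by ring. apply (is_derive_const (V := R_NormedModule)).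
Qed.

Lemma smooth_on_flat (n : nat) : smooth_on everywhere (flat n).
Proof.
  intros k. revert n. induction k as [k IH] using (well_founded_induction Wf_nat.lt_wf).
  intros n t _. destruct k as [|k]; [exact I|].
  apply (ex_derive_n_S _ (fun u => flat (n + 2) u - INR n * flat (n + 1) u)).
  - apply filter_forall. intro u. apply is_derive_flat.
  - apply ex_derive_n_minus; apply filter_forall; intros u j hj.
    + apply IH; [lia|exact I].
    + apply ex_derive_n_scal_l, IH; [lia|exact I].
Qed.

(** The classical bump exp (-2 / (1 - t^2)), as a product in order to make evenness and
    smoothness immediate. *)
Definition bump (t : R) : R := flat 0 (1 * t + 1) * flat 0 (-1 * t + 1).

Lemma smooth_on_bump : smooth_on everywhere bump.
Proof.
  apply (smooth_on_mult _ open_everywhere);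
    apply smooth_on_affine, smooth_on_flat.
Qed.

Lemma bump_ge0 (t : R) : 0 <= bump t.
Proof.
  assert (h : forall u, 0 <= flat 0 u).
  { intro u. unfold flat. destruct (Rlt_dec 0 u); [|lra].
    simpl. generalize (exp_pos (- / u)). lra. }
  apply Rmult_le_pos; apply h.
Qed.

Lemma bump_even (t : R) : bump (- t) = bump t.
Proof.
  unfold bump. rewrite Rmult_comm. f_equal; f_equal; ring.
Qed.

Lemma bump_outside (t : R) : t <= -1 -> bump t = 0.
Proof.
  intro h. unfold bump, flat at 1. destruct (Rlt_dec 0 (1 * t + 1)); [lra|ring].
Qed.

Lemma bump_inside (t : R) : -1 < t < 1 -> bump t = exp (- (2 / (1 - t ^ 2))).
Proof.
  intro h. unfold bump, flat.
  destruct (Rlt_dec 0 (1 * t + 1)); [|lra]. destruct (Rlt_dec 0 (-1 * t + 1)); [|lra].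
  simpl. rewrite !Rmult_1_r, <- exp_plus. f_equal. field. split; nra.
Qed.

Lemma bump_increasing (s t : R) : s <= t <= 0 -> bump s <= bump t.
Proof.
  intros h. destruct (Rle_dec s (-1)) as [hs|hs].
  - rewrite (bump_outside s hs). apply bump_ge0.
  - rewrite !bump_inside by lra.
    assert (h2 : 2 / (1 - t ^ 2) <= 2 / (1 - s ^ 2)).
    { unfold Rdiv. apply Rmult_le_compat_l; [lra|]. apply Rinv_le_contravar; nra. }
    destruct (Req_dec (2 / (1 - t ^ 2)) (2 / (1 - s ^ 2))) as [e|e].
    + rewrite e. lra.
    + apply Rlt_le, exp_increasing. lra.
Qed.

(** * One-variable calculus *)

Lemma mean_value (f f' : R -> R) (a b : R) :
  a <= b -> (forall t, a <= t <= b -> is_derive f t (f' t)) ->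
  exists c, a <= c <= b /\ f b - f a = f' c * (b - a).
Proof.
  intros hab h. destruct (MVT_gen f a b f') as [c [hc e]];
    rewrite ?Rmin_left, ?Rmax_right in * by lra.
  - intros t ht. apply h. lra.
  - intros t ht. apply continuity_pt_filterlim.
    apply (ex_derive_continuous (K := R_AbsRing) (V := R_NormedModule)).
    exists (f' t). apply h, ht.
  - exists c. split; assumption.
Qed.

Lemma constant_of_derivative (f : R -> R) :
  (forall t, is_derive f t 0) -> forall s t, f s = f t.
Proof.
  intros h. assert (k : forall s t, s <= t -> f s = f t).
  { intros s t hst. destruct (mean_value f (fun _ => 0) s t hst (fun u _ => h u)) as [c [_ e]].
    lra. }
  intros s t. destruct (Rle_dec s t) as [d|d]; [apply k, d|symmetry; apply k; lra].
Qed.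

Lemma nondecreasing_of_derivative (f f' : R -> R) :
  (forall t, is_derive f t (f' t)) -> (forall t, 0 <= f' t) ->
  forall s t, s <= t -> f s <= f t.
Proof.
  intros h h0 s t hst. destruct (mean_value f f' s t hst (fun u _ => h u)) as [c [_ e]].
  specialize (h0 c). nra.
Qed.

Lemma primitive_exists (f : R -> R) :
  smooth_on everywhere f -> exists F, F (-1) = 0 /\ forall t, is_derive F t (f t).
Proof.
  intro hf.
  assert (hc : forall t, continuous f t).
  { intro t. apply (ex_derive_continuous (K := R_AbsRing) (V := R_NormedModule)).
    apply (hf 1%nat t I). }
  exists (fun t => RInt f (-1) t). split; [exact (RInt_point (-1) f)|].
  intro t. apply (is_derive_RInt f _ (-1) t); [|apply hc].
  apply filter_forall. intro b. apply (RInt_correct (V := R_CompleteNormedModule)).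
  apply (ex_RInt_continuous (V := R_CompleteNormedModule)). intros z _. apply hc.
Qed.

Lemma is_derive_reflect (f : R -> R) (l t : R) :
  is_derive f (- t) l -> is_derive (fun u => f (- u)) t (- l).
Proof.
  intro h. replace (- l) with (scal (opp one) l).
  - apply (is_derive_comp f (fun u => - u)); [exact h|].
    apply (is_derive_opp (fun u => u) t one). apply is_derive_id.
  - unfold scal, opp, one; simpl. unfold mult; simpl. ring.
Qed.

(** * A smoothing of the corner of max(t, 0) *)

(** The functions f0, f1, f2, f3 are a smoothing of t |-> max (t, 0) and its first
    three derivatives.  By [corner_symmetric] the deviation f0 t - t from
    the right half of the corner is f0 (- t), so that both halves obey the same
    estimates.  [corner_chain] is the property that controls curvature: near
    the end -1 of the transition, and up to its middle, the second derivative
    dominates the function and the slope, so that curvature gained by bending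
    exceeds whatever is lost because the curve has moved and turned. *)
Record convex_corner (f0 f1 f2 f3 : R -> R) (m K : R) : Prop := {
  corner_smooth : smooth_on everywhere f0;
  corner_derive0 : forall t, is_derive f0 t (f1 t);
  corner_derive1 : forall t, is_derive f1 t (f2 t);
  corner_derive2 : forall t, is_derive f2 t (f3 t);
  corner_left : forall t, t <= -1 -> f0 t = 0 /\ f1 t = 0 /\ f2 t = 0;
  corner_symmetric : forall t, f0 t - f0 (- t) = t;
  corner_chain : forall t, t <= 0 -> 0 <= f0 t <= f1 t /\ f1 t <= f2 t;
  corner_slope : forall t, 0 <= f1 t <= 1;
  corner_positive : 0 < m;
  corner_bend : forall t, -1/2 <= t <= 1/2 -> m <= f2 t;
  corner_bound : forall t, Rabs (f2 t) <= K /\ Rabs (f3 t) <= K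
}.

Lemma continuous_bounded (f : R -> R) (a b : R) :
  (forall t, continuous f t) -> exists K, forall t, a <= t <= b -> Rabs (f t) <= K.
Proof.
  intro hf. destruct (Rle_dec a b) as [hab|hab].
  - destruct (continuity_ab_maj (fun t => Rabs (f t)) a b hab) as [x [hx _]].
    + intros c _. apply continuity_pt_filterlim.
      apply (continuous_comp f Rabs); [apply hf|]. apply continuous_Rabs.
    + exists (Rabs (f x)). exact hx.
  - exists 0. intros; lra.
Qed.

(** Integrate twice the bump normalized to have integral 1.  Evenness of the bump makes
    the slope satisfy f1 t + f1 (- t) = 1, hence the symmetry of f0.  On [-1, 0] the
    bump is nondecreasing, and on an interval of length at most 1 starting at a zero
    the integral of a nondecreasing function is at most its last value; applied twice
    this gives f0 <= f1 <= f2. *)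
Lemma convex_corner_exists : exists f0 f1 f2 f3 m K, convex_corner f0 f1 f2 f3 m K.
Proof.
  destruct (primitive_exists bump smooth_on_bump) as [B [B0 hB]].
  assert (Bmono := nondecreasing_of_derivative B bump hB bump_ge0).
  assert (hI : 0 < B 1).
  { destruct (mean_value B bump (-1/2) 0 ltac:(lra) (fun t _ => hB t)) as [c [hc e]].
    rewrite bump_inside in e by lra.
    generalize (exp_pos (- (2 / (1 - c ^ 2)))); intro q.
    generalize (Bmono (-1) (-1/2) ltac:(lra)), (Bmono 0 1 ltac:(lra)). nra. }
  set (k := / B 1). assert (hk : 0 < k) by (apply Rinv_0_lt_compat, hI).
  assert (hkI : B 1 * k = 1) by (unfold k; field; lra).
  set (f2 := fun t => bump t * k). set (f1 := fun t => B t * k).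
  assert (s2 : smooth_on everywhere f2).
  { apply (smooth_on_mult _ open_everywhere); [apply smooth_on_bump|apply smooth_on_const]. }
  assert (d1 : forall t, is_derive f1 t (f2 t)).
  { intro t. apply (is_derive_ext (fun u => scal k (B u))).
    - intro u. unfold f1, scal; simpl. unfold mult; simpl. ring.
    - replace (f2 t) with (scal k (bump t)) by (unfold f2, scal; simpl; unfold mult; simpl; ring).
      apply is_derive_scal, hB. }
  assert (s1 : smooth_on everywhere f1).
  { apply (smooth_on_primitive _ open_everywhere f1 f2); [intros t _; apply d1|exact s2]. }
  destruct (primitive_exists f1 s1) as [f0 [f00 d0]].
  assert (s0 : smooth_on everywhere f0).
  { apply (smooth_on_primitive _ open_everywhere f0 f1); [intros t _; apply d0|exact s1]. }
  assert (p2 : forall t, 0 <= f2 t) by (intro t; apply Rmult_le_pos; [apply bump_ge0|lra]).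
  assert (m1 := nondecreasing_of_derivative f1 f2 d1 p2).
  assert (f1m : f1 (-1) = 0) by (unfold f1; rewrite B0; ring).
  assert (f11 : f1 1 = 1) by exact hkI.
  assert (z2 : forall t, t <= -1 -> f2 t = 0).
  { intros t ht. unfold f2. rewrite bump_outside by exact ht. ring. }
  assert (z1 : forall t, t <= -1 -> f1 t = 0).
  { intros t ht. destruct (mean_value f1 f2 t (-1) ht (fun u _ => d1 u)) as [c [hc e]].
    rewrite z2 in e by lra. lra. }
  assert (z0 : forall t, t <= -1 -> f0 t = 0).
  { intros t ht. destruct (mean_value f0 f1 t (-1) ht (fun u _ => d0 u)) as [c [hc e]].
    rewrite z1 in e by lra. lra. }
  assert (e1 : forall t, f1 t + f1 (- t) = 1).
  { intro t. replace 1 with (f1 1 + f1 (- (1))) by (rewrite f11; replace (- (1)) with (-1) by ring; lra).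
    apply (constant_of_derivative (fun u => f1 u + f1 (- u))). intro u.
    replace 0 with (plus (f2 u) (- f2 (- u))).
    - apply (is_derive_plus f1 (fun u => f1 (- u))); [apply d1|].
      apply is_derive_reflect, d1.
    - unfold plus, f2; simpl. rewrite bump_even. ring. }
  assert (e0 : forall t, f0 t - f0 (- t) = t).
  { intro t. enough (f0 t - f0 (- t) - t = f0 0 - f0 (- 0) - 0) by (rewrite Ropp_0 in *; lra).
    apply (constant_of_derivative (fun u => f0 u - f0 (- u) - u)). intro u.
    replace 0 with (minus (minus (f1 u) (- f1 (- u))) 1).
    - apply (is_derive_minus (fun u => f0 u - f0 (- u)) (fun u => u)); [|apply (is_derive_id u)].
      apply (is_derive_minus f0 (fun u => f0 (- u))); [apply d0|].
      apply is_derive_reflect, d0.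
    - unfold minus, plus, opp; simpl. generalize (e1 u). lra. }
  assert (q1 : forall t, 0 <= f1 t).
  { intro t. destruct (Rle_dec t (-1)) as [h|h]; [rewrite z1; lra|].
    generalize (m1 (-1) t ltac:(lra)). lra. }
  assert (m0 := nondecreasing_of_derivative f0 f1 d0 q1).
  set (f3 := Derive f2).
  assert (d2 : forall t, is_derive f2 t (f3 t)).
  { intro t. apply (smooth_on_is_derive everywhere f2 t s2 I). }
  assert (s3 := smooth_on_Derive everywhere f2 s2).
  assert (cont : forall g, smooth_on everywhere g -> forall t, continuous g t).
  { intros g hg t. apply (ex_derive_continuous (K := R_AbsRing) (V := R_NormedModule)).
    apply (hg 1%nat t I). }
  destruct (continuous_bounded f2 (-1) 1 (cont _ s2)) as [K2 b2].
  destruct (continuous_bounded f3 (-1) 1 (cont _ s3)) as [K3 b3].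
  assert (out : forall t, ~ (-1 <= t <= 1) -> f2 t = 0).
  { intros t h. destruct (Rle_dec t (-1)) as [h1|h1]; [apply z2, h1|].
    unfold f2. rewrite <- bump_even, bump_outside by lra. ring. }
  assert (out3 : forall t, ~ (-1 <= t <= 1) -> f3 t = 0).
  { intros t h. apply is_derive_unique. apply (is_derive_ext_loc (fun _ => 0)).
    - destruct (Rlt_dec t (-1)) as [h1|h1].
      + apply (filter_imp (fun u => u < -1)); [|apply (open_lt (-1)), h1].
        intros u hu. symmetry. apply out. lra.
      + apply (filter_imp (fun u => 1 < u)); [|apply (open_gt 1); lra].
        intros u hu. symmetry. apply out. lra.
    - apply (is_derive_const (V := R_NormedModule)). }
  exists f0, f1, f2, f3, (f2 (-1/2)), (Rmax K2 K3). constructor; try assumption.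
  - intros t ht. repeat split; auto.
  - intros t ht. destruct (Rle_dec t (-1)) as [h|h].
    + rewrite z0, z1, z2 by lra. lra.
    + assert (k2 : forall c, c <= t -> f2 c <= f2 t).
      { intros c hc. apply Rmult_le_compat_r; [lra|]. apply bump_increasing. lra. }
      destruct (mean_value f0 f1 (-1) t ltac:(lra) (fun u _ => d0 u)) as [c [hc e]].
      destruct (mean_value f1 f2 (-1) t ltac:(lra) (fun u _ => d1 u)) as [c' [hc' e']].
      generalize (m1 c t ltac:(lra)), (k2 c' ltac:(lra)), (q1 c), (p2 c'). nra.
  - intro t. split; [apply q1|]. generalize (e1 t), (q1 (- t)). lra.
  - apply Rmult_lt_0_compat; [|exact hk]. rewrite bump_inside by lra. apply exp_pos.
  - intros t ht. apply Rmult_le_compat_r; [lra|].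
    destruct (Rle_dec t 0) as [h|h]; [apply bump_increasing; lra|].
    rewrite <- (bump_even t). apply bump_increasing. lra.
  - intro t. destruct (Rle_dec (-1) t) as [h1|h1]; [destruct (Rle_dec t 1) as [h2|h2]|].
    + split.
      * eapply Rle_trans; [apply b2; lra|apply Rmax_l].
      * eapply Rle_trans; [apply b3; lra|apply Rmax_r].
    + assert (0 <= Rmax K2 K3).
      { eapply Rle_trans; [apply Rabs_pos|]. eapply Rle_trans; [apply (b2 0); lra|apply Rmax_l]. }
      rewrite out, out3, Rabs_R0 by lra. lra.
    + assert (0 <= Rmax K2 K3).
      { eapply Rle_trans; [apply Rabs_pos|]. eapply Rle_trans; [apply (b2 0); lra|apply Rmax_l]. }
      rewrite out, out3, Rabs_R0 by lra. lra.
Qed.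

(** * Mean curvature of a surface of revolution *)

(** At distance y from the axis, with velocity (v3, v1) and acceleration (a3, a1), the
    principal curvatures are the clockwise curvature of the profile and, for the
    parallel circle, the component along the axis of the unit tangent over y. *)
Definition rotation_mean_curvature (y v3 v1 a3 a1 : R) : R :=
  let rho := sqrt (v3 * v3 + v1 * v1) in
  ((a3 * v1 - a1 * v3) / rho ^ 3 + v3 / (rho * y)) / 2.

Definition profile_mean_curvature (r : R -> plane) (s : R) : R :=
  rotation_mean_curvature (x1 (r s)) (x3 (velocity r s)) (x1 (velocity r s))
    (Derive (Derive (fun t => x3 (r t))) s) (Derive (Derive (fun t => x1 (r t))) s).

(** Both fundamental forms of a surface of revolution are diagonal in the coordinates
    (s, a), so det (II - k I) factors and its roots are L / E and P / G.
    Conversely, a factorization of a polynomial determines the sum of the roots, by its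
    values at k = 0 and k = 1. *)
Lemma is_revolution_mean_curvature_iff (r : R -> plane) (s h : R) :
  velocity r s <> (0, 0) -> x1 (r s) <> 0 ->
  (is_revolution_mean_curvature r s h <-> h = profile_mean_curvature r s).
Proof.
  intros hv hy.
  unfold is_revolution_mean_curvature, is_mean_curvature, principal_curvatures,
    profile_mean_curvature, rotation_mean_curvature.
  set (X := revolution r).
  set (y := x1 (r s)) in *.
  set (f3 := fun t => x3 (r t)). set (f1 := fun t => x1 (r t)).
  set (v3 := x3 (velocity r s)). set (v1 := x1 (velocity r s)).
  set (a3 := Derive (Derive f3) s). set (a1 := Derive (Derive f1) s).
  set (rho := sqrt (v3 * v3 + v1 * v1)).
  assert (hs : d_s X = fun t b => (Derive f1 t * cos b, Derive f1 t * sin b, Derive f3 t)).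
  { apply functional_extensionality; intro t.
    apply functional_extensionality; intro b.
    unfold d_s, Derive3, X, revolution, coord1, coord2, coord3; simpl.
    rewrite !Derive_scal_l. reflexivity. }
  assert (ha : d_a X = fun t b => (- (f1 t * sin b), f1 t * cos b, 0)).
  { apply functional_extensionality; intro t.
    apply functional_extensionality; intro b.
    unfold d_a, Derive3, X, revolution, coord1, coord2, coord3; simpl.
    rewrite Derive_const. f_equal; f_equal; apply is_derive_unique; auto_derive; auto;
      unfold f1; ring. }
  assert (hss : d_s (d_s X) s 0 = (a1, 0, a3)).
  { rewrite hs. unfold d_s, Derive3, coord1, coord2, coord3; simpl.
    rewrite !Derive_scal_l, cos_0, sin_0. f_equal; f_equal; unfold a1; ring. }
  assert (hsa : d_s (d_a X) s 0 = (0, Derive f1 s, 0)).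
  { rewrite ha. unfold d_s, Derive3, coord1, coord2, coord3; simpl.
    rewrite Derive_opp, !Derive_scal_l, Derive_const, cos_0, sin_0. f_equal; f_equal; ring. }
  assert (haa : d_a (d_a X) s 0 = (- y, 0, 0)).
  { rewrite ha. unfold d_a, Derive3, coord1, coord2, coord3; simpl.
    rewrite Derive_const. f_equal; f_equal; apply is_derive_unique; auto_derive; auto;
      rewrite ?cos_0, ?sin_0; unfold y, f1; ring. }
  assert (hN : revolution_normal r s 0 = (- (v3 / rho), 0, v1 / rho)).
  { change (revolution_normal r s 0)
      with (- (v3 / rho) * cos 0, - (v3 / rho) * sin 0, v1 / rho).
    rewrite cos_0, sin_0. apply f_equal2; [apply f_equal2|reflexivity]; ring. }
  assert (hS : 0 < v3 * v3 + v1 * v1).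
  { destruct (Req_dec v3 0) as [e3|e3]; [destruct (Req_dec v1 0) as [e1|e1]|].
    - exfalso. apply hv. rewrite (surjective_pairing (velocity r s)).
      fold (x3 (velocity r s)) (x1 (velocity r s)). fold v3 v1. rewrite e3, e1. reflexivity.
    - nra.
    - nra. }
  assert (hr : 0 < rho) by (apply sqrt_lt_R0, hS).
  assert (hr2 : v3 * v3 + v1 * v1 = rho ^ 2) by (unfold rho; rewrite pow2_sqrt; lra).
  rewrite hss, hsa, haa, hN, hs, ha.
  unfold dot3, coord1, coord2, coord3; simpl fst; simpl snd.
  rewrite cos_0, sin_0.
  change (Derive f1 s) with v1. change (Derive f3 s) with v3. change (f1 s) with y.
  assert (hy2 : 0 < y * y) by nra.
  set (k := (a3 * v1 - a1 * v3) / rho ^ 3). set (l := v3 / (rho * y)).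
  match goal with |- context [?E * ?G - ?F ^ 2 <> 0] =>
    assert (hE : E = rho ^ 2) by (rewrite <- hr2; ring);
    assert (hG : G = y ^ 2) by ring; assert (hF : F = 0) by ring;
    rewrite hE, hG, hF end.
  match goal with |- context [(?L - _ * _) * (?P - _ * _) - (?M - _ * _) ^ 2] =>
    assert (hL : L = k * rho ^ 2) by (unfold k; field; lra);
    assert (hP : P = l * y ^ 2) by (unfold l; field; lra); assert (hM : M = 0) by ring;
    rewrite hL, hP, hM end.
  assert (hEG : rho ^ 2 * y ^ 2 <> 0) by (apply Rmult_integral_contrapositive_currified; nra).
  split.
  - intros [k1 [k2 [[_ hk] e]]]. rewrite e.
    assert (q : forall z, (k - z) * (l - z) = (z - k1) * (z - k2)).
    { intro z. apply (Rmult_eq_reg_l (rho ^ 2 * y ^ 2)); [|exact hEG].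
      generalize (hk z). intro hz. transitivity ((rho ^ 2 * y ^ 2 - 0 ^ 2) * ((z - k1) * (z - k2))); [|ring].
      rewrite <- hz. ring. }
    generalize (q 0), (q 1). lra.
  - intro e. exists k, l. split; [split|exact e].
    + replace (rho ^ 2 * y ^ 2 - 0 ^ 2) with (rho ^ 2 * y ^ 2) by ring. exact hEG.
    + intro z. ring.
Qed.

Lemma Rabs_mult_le (a b A B : R) : Rabs a <= A -> Rabs b <= B -> Rabs (a * b) <= A * B.
Proof.
  intros ha hb. rewrite Rabs_mult. apply Rmult_le_compat; try apply Rabs_pos; assumption.
Qed.

(** The quantitative heart of the argument.  Lower case is a point of a unit speed curve,
    upper case the corresponding point of the bent curve.  Position and velocity have
    moved by O(u), but the acceleration has gained (u / eps) V up to O(u).  This changes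
    the curvature of the profile by about (u / eps) times the determinant in the last
    hypothesis, whereas every other change of the mean curvature is O(u).  For small eps
    the gain wins, whatever the size of u. *)
Lemma mean_curvature_increases (M C c y0 : R) :
  0 < M -> 0 < C -> 0 < c -> 0 < y0 ->
  exists e0, 0 < e0 /\
  forall eps u q1 p3 p1 k3 k1 Q1 P3 P1 K3 K1 V3 V1,
  0 < eps < e0 -> 0 <= u ->
  p3 * p3 + p1 * p1 = 1 -> Rabs k3 <= M -> Rabs k1 <= M ->
  y0 <= q1 -> y0 <= Q1 -> Rabs (Q1 - q1) <= C * u ->
  Rabs (P3 - p3) <= C * u -> Rabs (P1 - p1) <= C * u ->
  Rabs (K3 - k3 - u / eps * V3) <= C * u ->
  Rabs (K1 - k1 - u / eps * V1) <= C * u ->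
  Rabs P3 <= M -> Rabs P1 <= M -> c <= P3 * P3 + P1 * P1 ->
  c <= V3 * P1 - V1 * P3 ->
  rotation_mean_curvature q1 p3 p1 k3 k1 <= rotation_mean_curvature Q1 P3 P1 K3 K1.
Proof.
  intros hM hC hc hy0.
  (* L bounds the speed rho of the bent curve, J u its deviation from 1, and A u
     collects all changes other than the gain u c / eps, after multiplication by rho^3 *)
  set (L := 1 + 2 * M ^ 2). set (J := 2 * C * (M + 1)). set (i := / y0).
  assert (hi : 0 < i) by (apply Rinv_0_lt_compat, hy0).
  assert (hL : 1 <= L) by (unfold L; nra).
  assert (hJ : 0 < J) by (unfold J; nra).
  set (A := 4 * M * C + 2 * M * (J * (L ^ 2 + L + 1)) + L ^ 2 * (C * i + C * (i * i))
            + L ^ 2 * (J * i)).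
  assert (hA : 0 < A).
  { unfold A. assert (0 < M * C) by nra. assert (0 < J * (L ^ 2 + L + 1)) by nra.
    assert (0 < L ^ 2) by nra. assert (0 < C * i) by nra. assert (0 < C * (i * i)) by nra.
    assert (0 < J * i) by nra. nra. }
  exists (c / A). split; [apply Rdiv_lt_0_compat; assumption|].
  intros eps u q1 p3 p1 k3 k1 Q1 P3 P1 K3 K1 V3 V1 [he0 he] hu hp hk3 hk1 hq hQ dQ dP3 dP1
    dK3 dK1 hP3 hP1 hS hV.
  unfold rotation_mean_curvature. rewrite hp, sqrt_1.
  set (S := P3 * P3 + P1 * P1) in *. set (rho := sqrt S).
  assert (hr : 0 < rho) by (apply sqrt_lt_R0; lra).
  assert (hr2 : rho ^ 2 = S) by (unfold rho; rewrite pow2_sqrt; lra).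
  assert (hrL : rho <= L).
  { apply Rabs_le_between in hP3. apply Rabs_le_between in hP1.
    assert (S <= 2 * M ^ 2) by (unfold S; nra). unfold L. nra. }
  assert (hp3 : Rabs p3 <= 1) by (apply Rabs_le; nra).
  assert (hp1 : Rabs p1 <= 1) by (apply Rabs_le; nra).
  assert (dr : Rabs (rho - 1) <= J * u).
  { apply Rle_trans with (Rabs (S - 1)).
    - replace (S - 1) with ((rho - 1) * (rho + 1)) by (rewrite <- hr2; ring).
      rewrite Rabs_mult, (Rabs_pos_eq (rho + 1)) by lra.
      generalize (Rabs_pos (rho - 1)). nra.
    - replace (S - 1) with ((P3 - p3) * (P3 + p3) + (P1 - p1) * (P1 + p1))
        by (unfold S; rewrite <- hp; ring).
      eapply Rle_trans; [apply Rabs_triang|].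
      replace (J * u) with (C * u * (M + 1) + C * u * (M + 1)) by (unfold J; ring).
      apply Rplus_le_compat; apply Rabs_mult_le; try assumption;
        (eapply Rle_trans; [apply Rabs_triang|lra]). }
  set (n := k3 * p1 - k1 * p3). set (N := K3 * P1 - K1 * P3).
  assert (hn : Rabs n <= 2 * M).
  { unfold n, Rminus. eapply Rle_trans; [apply Rabs_triang|]. rewrite Rabs_Ropp.
    generalize (Rabs_mult_le _ _ _ _ hk3 hp1), (Rabs_mult_le _ _ _ _ hk1 hp3). lra. }
  assert (hN : n + u / eps * c - 4 * M * C * u <= N).
  { replace N with (n + u / eps * (V3 * P1 - V1 * P3)
      + ((K3 - k3 - u / eps * V3) * P1 - (K1 - k1 - u / eps * V1) * P3
         + (k3 * (P1 - p1) - k1 * (P3 - p3)))) by (unfold N, n; ring).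
    assert (hb : 0 <= u / eps).
    { unfold Rdiv. apply Rmult_le_pos; [lra|]. apply Rlt_le, Rinv_0_lt_compat, he0. }
    assert (g1 := Rabs_mult_le _ _ _ _ dK3 hP1). assert (g2 := Rabs_mult_le _ _ _ _ dK1 hP3).
    assert (g3 := Rabs_mult_le _ _ _ _ hk3 dP1). assert (g4 := Rabs_mult_le _ _ _ _ hk1 dP3).
    apply Rabs_le_between in g1. apply Rabs_le_between in g2.
    apply Rabs_le_between in g3. apply Rabs_le_between in g4.
    assert (u / eps * c <= u / eps * (V3 * P1 - V1 * P3)) by (apply Rmult_le_compat_l; lra).
    lra. }
  assert (hrL2 : rho ^ 2 <= L ^ 2) by (apply pow_incr; lra).
  assert (hr0 : 0 <= rho ^ 2) by (apply pow2_ge_0).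
  assert (hi1 : forall z, y0 <= z -> Rabs (/ z) <= i).
  { intros z hz. rewrite Rabs_pos_eq; [apply Rinv_le_contravar; lra|].
    apply Rlt_le, Rinv_0_lt_compat. lra. }
  assert (g5 : Rabs (n * ((rho - 1) * (rho ^ 2 + rho + 1))) <= 2 * M * (J * u * (L ^ 2 + L + 1))).
  { apply Rabs_mult_le; [exact hn|]. apply Rabs_mult_le; [exact dr|].
    rewrite Rabs_pos_eq by lra. lra. }
  assert (hr2L : Rabs (rho ^ 2) <= L ^ 2) by (rewrite Rabs_pos_eq; assumption).
  assert (g6 : Rabs (rho ^ 2 * ((P3 - p3) * / Q1 + - p3 * ((Q1 - q1) * (/ Q1 * / q1))))
               <= L ^ 2 * (C * u * i + 1 * (C * u * (i * i)))).
  { apply Rabs_mult_le; [exact hr2L|]. eapply Rle_trans; [apply Rabs_triang|].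
    apply Rplus_le_compat; repeat apply Rabs_mult_le; rewrite ?Rabs_Ropp; try assumption; apply hi1; assumption. }
  assert (g7 : Rabs (rho ^ 2 * ((rho - 1) * (p3 * / q1))) <= L ^ 2 * (J * u * (1 * i))).
  { apply Rabs_mult_le; [exact hr2L|]. apply Rabs_mult_le; [exact dr|].
    apply Rabs_mult_le; [exact hp3|]. apply hi1, hq. }
  apply Rabs_le_between in g5. apply Rabs_le_between in g6. apply Rabs_le_between in g7.
  assert (hfin : A * u <= u / eps * c).
  { apply (Rmult_le_reg_r eps); [exact he0|].
    replace (u / eps * c * eps) with (u * c) by (field; lra).
    apply (Rmult_lt_compat_r A) in he; [|exact hA].
    replace (c / A * A) with c in he by (field; lra). nra. }
  assert (hgoal : n * rho ^ 3 + rho ^ 3 * (p3 * / q1) <= N + rho ^ 2 * (P3 * / Q1)).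
  { replace (n * rho ^ 3) with (n + n * ((rho - 1) * (rho ^ 2 + rho + 1))) by ring.
    replace (rho ^ 2 * (P3 * / Q1)) with
      (rho ^ 3 * (p3 * / q1) - rho ^ 2 * ((rho - 1) * (p3 * / q1))
       + rho ^ 2 * ((P3 - p3) * / Q1 + - p3 * ((Q1 - q1) * (/ Q1 * / q1)))) by (field; lra).
    unfold A in hfin. lra. }
  apply Rmult_le_compat_r; [lra|].
  apply (Rmult_le_reg_r (rho ^ 3)); [apply pow_lt, hr|].
  replace ((n / 1 ^ 3 + p3 / (1 * q1)) * rho ^ 3) with (n * rho ^ 3 + rho ^ 3 * (p3 * / q1))
    by (field; lra).
  replace ((N / rho ^ 3 + P3 / (rho * Q1)) * rho ^ 3) with (N + rho ^ 2 * (P3 * / Q1))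
    by (field; lra).
  exact hgoal.
Qed.

Lemma corner_slope_symmetric c0 c1 c2 c3 m K (cc : convex_corner c0 c1 c2 c3 m K) (t : R) :
  c1 t + c1 (- t) = 1.
Proof.
  assert (h : is_derive (fun u => c0 u - c0 (- u)) t (c1 t + c1 (- t))).
  { replace (c1 t + c1 (- t)) with (minus (c1 t) (- c1 (- t)))
      by (unfold minus, plus, opp; simpl; ring).
    apply (is_derive_minus c0 (fun u => c0 (- u))); [apply cc|].
    apply is_derive_reflect, cc. }
  apply is_derive_unique in h. rewrite <- h. apply is_derive_unique.
  apply (is_derive_ext (fun u => u)); [|apply (is_derive_id t)].
  intro u. symmetry. apply (corner_symmetric _ _ _ _ _ _ cc).
Qed.

Lemma corner_bend_even c0 c1 c2 c3 m K (cc : convex_corner c0 c1 c2 c3 m K) (t : R) :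
  c2 (- t) = c2 t.
Proof.
  assert (h : is_derive (fun u => c1 u + c1 (- u)) t (c2 t + - c2 (- t))).
  { apply (is_derive_plus c1 (fun u => c1 (- u))); [apply cc|].
    apply is_derive_reflect, cc. }
  apply is_derive_unique in h.
  assert (h0 : Derive (fun u => c1 u + c1 (- u)) t = 0).
  { rewrite (Derive_ext _ (fun _ => 1)); [apply Derive_const|].
    intro u. apply (corner_slope_symmetric _ _ _ _ _ _ cc). }
  assert (q : c2 t + - c2 (- t) = 0) by exact (eq_trans (eq_sym h) h0). lra.
Qed.

Lemma corner_right c0 c1 c2 c3 m K (cc : convex_corner c0 c1 c2 c3 m K) (t : R) :
  1 <= t -> c0 t = t /\ c1 t = 1 /\ c2 t = 0.
Proof.
  intro ht. destruct (corner_left _ _ _ _ _ _ cc (- t) ltac:(lra)) as [e0 [e1 e2]].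
  generalize (corner_symmetric _ _ _ _ _ _ cc t), (corner_slope_symmetric _ _ _ _ _ _ cc t),
    (corner_bend_even _ _ _ _ _ _ cc t). lra.
Qed.

Lemma corner_flat_outside c0 c1 c2 c3 m K (cc : convex_corner c0 c1 c2 c3 m K) (t : R) :
  t < -1 \/ 1 < t -> c3 t = 0.
Proof.
  intro ht. rewrite <- (is_derive_unique c2 t (c3 t)) by apply cc.
  apply is_derive_unique. apply (is_derive_ext_loc (fun _ => 0)).
  - destruct ht as [ht|ht].
    + apply (filter_imp (fun u => u < -1)); [|apply (open_lt (-1)), ht].
      intros u hu. symmetry. apply (corner_left _ _ _ _ _ _ cc). lra.
    + apply (filter_imp (fun u => 1 < u)); [|apply (open_gt 1), ht].
      intros u hu. symmetry. apply (corner_right _ _ _ _ _ _ cc). lra.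
  - apply (is_derive_const (V := R_NormedModule)).
Qed.

(** * Blending two functions with the same value at 0 *)

Definition controlled (e M : R) (f : R -> R) : Prop :=
  smooth_on (fun t => Rabs t < e) f /\
  forall t, Rabs t < e ->
    Rabs (Derive f t) <= M /\ Rabs (Derive (Derive f) t) <= M /\
    Rabs (Derive f t - Derive f 0) <= M * Rabs t /\
    Rabs (f t - f 0 - t * Derive f 0) <= M * t ^ 2.

Lemma open_Rabs_lt (e : R) : open (fun t => Rabs t < e).
Proof.
  intros t ht. exists (mkposreal (e - Rabs t) ltac:(lra)). intros u hu.
  unfold ball in hu; simpl in hu. unfold AbsRing_ball, abs, minus, plus, opp in hu; simpl in hu.
  replace u with (t + (u + - t)) by ring.
  eapply Rle_lt_trans; [apply Rabs_triang|lra].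
Qed.

Lemma controlled_weaken (e e' M M' : R) (f : R -> R) :
  e' <= e -> M <= M' -> controlled e M f -> controlled e' M' f.
Proof.
  intros he hM [hs h]. split.
  - intros n t ht. apply hs. lra.
  - intros t ht. destruct (h t ltac:(lra)) as [a [b [c d]]].
    assert (0 <= Rabs t) by apply Rabs_pos. assert (0 <= t ^ 2) by apply pow2_ge_0.
    assert (M * Rabs t <= M' * Rabs t) by (apply Rmult_le_compat_r; lra).
    assert (M * t ^ 2 <= M' * t ^ 2) by (apply Rmult_le_compat_r; lra).
    repeat split; lra.
Qed.

Lemma mean_value_at_0 (f f' : R -> R) (t : R) :
  (forall u, Rabs u <= Rabs t -> is_derive f u (f' u)) ->
  exists c, Rabs c <= Rabs t /\ f t - f 0 = f' c * t.
Proof.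
  intro h. destruct (Rle_dec 0 t) as [ht|ht].
  - destruct (mean_value f f' 0 t ht) as [c [hc e]].
    + intros u hu. apply h. rewrite !Rabs_pos_eq; lra.
    + exists c. split; [rewrite !Rabs_pos_eq; lra|]. rewrite e. ring.
  - destruct (mean_value f f' t 0 ltac:(lra)) as [c [hc e]].
    + intros u hu. apply h. rewrite !Rabs_left1; lra.
    + exists c. split; [rewrite !Rabs_left1; lra|]. lra.
Qed.

Lemma controlled_near (f : R -> R) :
  locally 0 (fun t => forall n, ex_derive_n f n t) ->
  exists e M, 0 < e /\ 0 < M /\ controlled e M f.
Proof.
  intros [d hd].
  assert (hs : smooth_on (fun t => Rabs t < d) f).
  { intros n t ht. apply hd. unfold ball; simpl.
    unfold AbsRing_ball, abs, minus, plus, opp; simpl. rewrite Ropp_0, Rplus_0_r. exact ht. }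
  assert (hs' := smooth_on_Derive _ f hs). assert (hs'' := smooth_on_Derive _ _ hs').
  assert (hd0 := cond_pos d).
  set (f2 := Derive (Derive f)) in *.
  assert (hc : continuous f2 0).
  { apply (ex_derive_continuous (K := R_AbsRing) (V := R_NormedModule)).
    apply (hs'' 1%nat). rewrite Rabs_R0. exact hd0. }
  set (A := Rabs (f2 0) + 1). assert (hA : 0 < A) by (generalize (Rabs_pos (f2 0)); unfold A; lra).
  apply continuity_pt_filterlim in hc. destruct (hc 1 ltac:(lra)) as [e [he h]].
  assert (b2 : forall t, Rabs t < Rmin d e -> Rabs (f2 t) <= A).
  { intros t ht. destruct (Req_dec t 0) as [h0|h0]; [rewrite h0; unfold A; lra|].
    assert (k : Rabs (f2 t - f2 0) < 1).
    { apply h. split; [split; [exact I|auto]|]. simpl. unfold R_dist. rewrite Rminus_0_r.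
      generalize (Rmin_r d e). lra. }
    unfold A. replace (f2 t) with (f2 t - f2 0 + f2 0) by ring.
    eapply Rle_trans; [apply Rabs_triang|]. lra. }
  assert (ml := Rmin_l d e).
  assert (b1 : forall t, Rabs t < Rmin d e -> Rabs (Derive f t - Derive f 0) <= A * Rabs t).
  { intros t ht. destruct (mean_value_at_0 (Derive f) f2 t) as [c [hc1 e1]].
    - intros u hu. apply (smooth_on_is_derive _ _ u hs'). lra.
    - rewrite e1, Rabs_mult. apply Rmult_le_compat_r; [apply Rabs_pos|]. apply b2. lra. }
  exists (Rmin 1 (Rmin d e)), (A + Rabs (Derive f 0)).
  assert (0 < Rmin d e) by (apply Rmin_glb_lt; assumption).
  assert (p0 := Rabs_pos (Derive f 0)).
  split; [apply Rmin_glb_lt; lra|]. split; [lra|].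
  generalize (Rmin_l 1 (Rmin d e)), (Rmin_r 1 (Rmin d e)); intros m1 m2.
  split.
  - intros n t ht. apply hs. lra.
  - intros t ht. assert (pt := Rabs_pos t).
    assert (bt := b1 t ltac:(lra)).
    split; [|split; [|split]].
    + replace (Derive f t) with (Derive f t - Derive f 0 + Derive f 0) by ring.
      eapply Rle_trans; [apply Rabs_triang|]. nra.
    + generalize (b2 t ltac:(lra)). fold f2. lra.
    + nra.
    + destruct (mean_value_at_0 (fun u => f u - u * Derive f 0)
                 (fun u => Derive f u - Derive f 0) t) as [c [hc1 e1]].
      * intros u hu. apply (is_derive_minus f (fun u => u * Derive f 0)).
        -- apply (smooth_on_is_derive _ _ u hs). lra.
        -- auto_derive; [exact I|ring].
      * replace (f t - f 0 - t * Derive f 0)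
          with (f t - t * Derive f 0 - (f 0 - 0 * Derive f 0)) by ring.
        rewrite e1, Rabs_mult. generalize (b1 c ltac:(lra)); intro bc.
        rewrite <- (pow2_abs t). generalize (Rabs_pos c). 
        assert (A * Rabs c <= A * Rabs t) by (apply Rmult_le_compat_l; lra).
        intro. assert (Rabs (Derive f c - Derive f 0) * Rabs t <= A * Rabs t * Rabs t)
          by (apply Rmult_le_compat_r; lra). nra.
Qed.

(** With c0 a smoothing of max (t, 0) and c1 its slope, this follows f up to -eps and g
    from eps on.  Even for affine f and g, switching from one to the other would not
    bend in one direction only; here the corner is made by the term eps c0 (s / eps) v, v being the jump of
    the slope, and the switch c1 (2 s / eps) acts only on g - f - s v, which is
    quadratically small.  The switch takes place in the middle half of [-eps, eps],
    where the bending c2 (s / eps) is bounded below and absorbs it. *)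
Definition blend (c0 c1 : R -> R) (eps : R) (f g : R -> R) (s : R) : R :=
  let v := Derive g 0 - Derive f 0 in
  f s + c1 (2 / eps * s) * (g s - f s - s * v) + eps * c0 (/ eps * s) * v.

Lemma blend_left c0 c1 c2 c3 m K (cc : convex_corner c0 c1 c2 c3 m K) eps f g s :
  0 < eps -> s <= - eps -> blend c0 c1 eps f g s = f s.
Proof.
  intros he hs. unfold blend.
  assert (h : / eps * s <= -1).
  { apply (Rmult_le_reg_l eps); [exact he|]. replace (eps * (/ eps * s)) with s by (field; lra). lra. }
  replace (2 / eps * s) with (2 * (/ eps * s)) by (field; lra).
  destruct (corner_left _ _ _ _ _ _ cc (/ eps * s) h) as [e0 _].
  destruct (corner_left _ _ _ _ _ _ cc (2 * (/ eps * s)) ltac:(lra)) as [_ [e1 _]].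
  rewrite e0, e1. ring.
Qed.

Lemma blend_right c0 c1 c2 c3 m K (cc : convex_corner c0 c1 c2 c3 m K) eps f g s :
  0 < eps -> eps <= s -> blend c0 c1 eps f g s = g s.
Proof.
  intros he hs. unfold blend.
  assert (h : 1 <= / eps * s).
  { apply (Rmult_le_reg_l eps); [exact he|]. replace (eps * (/ eps * s)) with s by (field; lra). lra. }
  replace (2 / eps * s) with (2 * (/ eps * s)) by (field; lra).
  destruct (corner_right _ _ _ _ _ _ cc (/ eps * s) h) as [e0 _].
  destruct (corner_right _ _ _ _ _ _ cc (2 * (/ eps * s)) ltac:(lra)) as [_ [e1 _]].
  rewrite e0, e1. field. lra.
Qed.

Lemma smooth_on_blend c0 c1 c2 c3 m K (cc : convex_corner c0 c1 c2 c3 m K) eps e f g :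
  smooth_on (fun t => Rabs t < e) f -> smooth_on (fun t => Rabs t < e) g ->
  smooth_on (fun t => Rabs t < e) (blend c0 c1 eps f g).
Proof.
  intros hf hg. assert (o := open_Rabs_lt e).
  assert (s0 := corner_smooth _ _ _ _ _ _ cc).
  assert (s1 : smooth_on everywhere c1).
  { intros n t ht. apply (ex_derive_n_ext (Derive c0)).
    - intro u. apply is_derive_unique, cc.
    - apply (smooth_on_Derive _ _ s0 n t ht). }
  assert (sc : forall c a, smooth_on everywhere c -> smooth_on (fun t => Rabs t < e) (fun t => c (a * t))).
  { intros c a hc. apply (smooth_on_ext _ o (fun t => c (a * t + 0))).
    - intros t _. rewrite Rplus_0_r. reflexivity.
    - apply smooth_on_affine, hc. }
  assert (s0' := sc c0 (/ eps) s0). assert (s1' := sc c1 (2 / eps) s1).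
  set (v := Derive g 0 - Derive f 0).
  apply (smooth_on_plus _ o
           (fun s => f s + c1 (2 / eps * s) * (g s - f s - s * v))
           (fun s => eps * c0 (/ eps * s) * v)).
  - apply (smooth_on_plus _ o f); [exact hf|].
    apply (smooth_on_mult _ o (fun s => c1 (2 / eps * s))); [exact s1'|].
    apply (smooth_on_minus _ o (fun s => g s - f s) (fun s => s * v)).
    + apply (smooth_on_minus _ o g f); assumption.
    + apply (smooth_on_mult _ o (fun s => s)); [apply smooth_on_id, o|apply smooth_on_const].
  - apply (smooth_on_mult _ o (fun s => eps * c0 (/ eps * s))); [|apply smooth_on_const].
    apply (smooth_on_mult _ o (fun _ => eps)); [apply smooth_on_const|exact s0'].
Qed.

Lemma is_derive_blend c0 c1 c2 c3 m K (cc : convex_corner c0 c1 c2 c3 m K) eps e f g :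
  0 < eps ->
  smooth_on (fun t => Rabs t < e) f -> smooth_on (fun t => Rabs t < e) g ->
  let v := Derive g 0 - Derive f 0 in
  forall s, Rabs s < e ->
  Derive (blend c0 c1 eps f g) s =
    Derive f s + (2 / eps * c2 (2 / eps * s) * (g s - f s - s * v)
      + c1 (2 / eps * s) * (Derive g s - Derive f s - v)) + c1 (/ eps * s) * v /\
  Derive (Derive (blend c0 c1 eps f g)) s =
    Derive (Derive f) s + (4 / eps ^ 2 * c3 (2 / eps * s) * (g s - f s - s * v)
      + 2 * (2 / eps * c2 (2 / eps * s)) * (Derive g s - Derive f s - v)
      + c1 (2 / eps * s) * (Derive (Derive g) s - Derive (Derive f) s))
      + c2 (/ eps * s) / eps * v.
Proof.
  intros he hf hg v.
  assert (d0 := corner_derive0 _ _ _ _ _ _ cc). assert (d1 := corner_derive1 _ _ _ _ _ _ cc).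
  assert (d2 := corner_derive2 _ _ _ _ _ _ cc).
  assert (e0 : forall t, Derive c0 t = c1 t) by (intro; apply is_derive_unique, d0).
  assert (e1 : forall t, Derive c1 t = c2 t) by (intro; apply is_derive_unique, d1).
  assert (e2 : forall t, Derive c2 t = c3 t) by (intro; apply is_derive_unique, d2).
  assert (x0 : forall t, ex_derive c0 t) by (intro; eexists; apply d0).
  assert (x1 : forall t, ex_derive c1 t) by (intro; eexists; apply d1).
  assert (x2 : forall t, ex_derive c2 t) by (intro; eexists; apply d2).
  assert (hf' := smooth_on_Derive _ f hf). assert (hg' := smooth_on_Derive _ g hg).
  assert (h1 : forall s, Rabs s < e -> Derive (blend c0 c1 eps f g) s =
    Derive f s + (2 / eps * c2 (2 / eps * s) * (g s - f s - s * v)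
      + c1 (2 / eps * s) * (Derive g s - Derive f s - v)) + c1 (/ eps * s) * v).
  { intros s hs. apply is_derive_unique. unfold blend. fold v.
    assert (ex_derive f s) by apply (hf 1%nat s hs).
    assert (ex_derive g s) by apply (hg 1%nat s hs).
    auto_derive; [repeat split; auto|].
    change (fun x => f x) with f. change (fun x => g x) with g.
    change (fun x => c0 x) with c0. change (fun x => c1 x) with c1.
    rewrite e0, e1. field. lra. }
  intros s hs. split; [exact (h1 s hs)|].
  rewrite (Derive_ext_loc _ (fun s => Derive f s + (2 / eps * c2 (2 / eps * s) * (g s - f s - s * v)
      + c1 (2 / eps * s) * (Derive g s - Derive f s - v)) + c1 (/ eps * s) * v)).
  2: { apply (filter_imp (fun t => Rabs t < e)); [exact h1|apply open_Rabs_lt, hs]. }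
  apply is_derive_unique.
  assert (ex_derive f s) by apply (hf 1%nat s hs).
  assert (ex_derive g s) by apply (hg 1%nat s hs).
  assert (ex_derive (Derive f) s) by apply (hf' 1%nat s hs).
  assert (ex_derive (Derive g) s) by apply (hg' 1%nat s hs).
  auto_derive; [repeat split; auto|].
  change (fun x => f x) with f. change (fun x => g x) with g.
  change (fun x => Derive f x) with (Derive f). change (fun x => Derive g x) with (Derive g).
  change (fun x => c2 x) with c2. change (fun x => c1 x) with c1.
  rewrite e1, !e2, e1. field. lra.
Qed.

Lemma controlled_lipschitz (e M : R) (f : R -> R) (t : R) :
  controlled e M f -> Rabs t < e -> Rabs (f t - f 0) <= M * Rabs t.
Proof.
  intros [hs h] ht. destruct (mean_value_at_0 f (Derive f) t) as [c [hc ec]].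
  - intros u hu. apply (smooth_on_is_derive _ f u hs). lra.
  - rewrite ec, Rabs_mult. apply Rmult_le_compat_r; [apply Rabs_pos|].
    apply (h c ltac:(lra)).
Qed.

(** The three lines bound a switched remainder and its first two derivatives.  Each
    derivative of the switch costs a factor 1 / eps, which the Taylor bounds on the
    remainder E compensate. *)
Lemma switch_terms_bound (K M eps b a1 a2 E E' E'' : R) :
  0 <= K -> 0 <= M -> 0 < eps <= 1 ->
  Rabs b <= 1 -> Rabs a1 <= K -> Rabs a2 <= K ->
  Rabs E <= M * eps ^ 2 -> Rabs E' <= M * eps -> Rabs E'' <= M ->
  let B := 8 * K * M + M in
  Rabs (b * E) <= B * eps /\
  Rabs (2 / eps * a1 * E + b * E') <= B * eps /\
  Rabs (4 / eps ^ 2 * a2 * E + 2 * (2 / eps * a1) * E' + b * E'') <= B.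
Proof.
  intros hK hM [he he1] hb h1 h2 hE hE' hE'' B.
  set (G := E / eps ^ 2). set (G' := E' / eps).
  assert (eE : E = G * eps ^ 2) by (unfold G; field; lra).
  assert (eE' : E' = G' * eps) by (unfold G'; field; lra).
  assert (hG : Rabs G <= M).
  { apply (Rmult_le_reg_r (eps ^ 2)); [apply pow_lt, he|].
    rewrite <- (Rabs_pos_eq (eps ^ 2)) at 1 by (apply pow_le; lra).
    rewrite <- Rabs_mult, <- eE. exact hE. }
  assert (hG' : Rabs G' <= M).
  { apply (Rmult_le_reg_r eps); [exact he|].
    rewrite <- (Rabs_pos_eq eps) at 1 by lra. rewrite <- Rabs_mult, <- eE'. exact hE'. }
  assert (k1 := Rabs_mult_le _ _ _ _ hb hG). assert (k2 := Rabs_mult_le _ _ _ _ h1 hG).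
  assert (k3 := Rabs_mult_le _ _ _ _ hb hG'). assert (k4 := Rabs_mult_le _ _ _ _ h2 hG).
  assert (k5 := Rabs_mult_le _ _ _ _ h1 hG'). assert (k6 := Rabs_mult_le _ _ _ _ hb hE'').
  assert (hKM : 0 <= K * M) by (apply Rmult_le_pos; assumption).
  apply Rabs_le_between in k1. apply Rabs_le_between in k2. apply Rabs_le_between in k3.
  apply Rabs_le_between in k4. apply Rabs_le_between in k5. apply Rabs_le_between in k6.
  split; [|split].
  - rewrite eE. replace (b * (G * eps ^ 2)) with (b * G * eps * eps) by ring.
    rewrite Rabs_mult, (Rabs_pos_eq eps) by lra. apply Rmult_le_compat_r; [lra|].
    unfold B. apply Rabs_le. split; nra.
  - rewrite eE, eE'.
    replace (2 / eps * a1 * (G * eps ^ 2) + b * (G' * eps)) with ((2 * (a1 * G) + b * G') * eps)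
      by (field; lra).
    rewrite Rabs_mult, (Rabs_pos_eq eps) by lra. apply Rmult_le_compat_r; [lra|].
    unfold B. apply Rabs_le. split; lra.
  - rewrite eE, eE'.
    replace (4 / eps ^ 2 * a2 * (G * eps ^ 2) + 2 * (2 / eps * a1) * (G' * eps) + b * E'')
      with (4 * (a2 * G) + 4 * (a1 * G') + b * E'') by (field; lra).
    unfold B. apply Rabs_le. split; lra.
Qed.

(** The parameter u measures how strongly F is bent at s.  All errors are relative to u,
    and smaller than the bending (u / eps) v by the factor eps, so that the comparison
    survives at the ends of the transition, where u tends to 0. *)
Definition bent_close (C eps u v : R) (F f : R -> R) (s : R) : Prop :=
  Rabs (F s - f s) <= C * u /\ Rabs (Derive F s - Derive f s) <= C * u /\
  Rabs (Derive (Derive F) s - Derive (Derive f) s - u / eps * v) <= C * u.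

(** For s <= 0, F - f is the switched remainder plus eps c0 (s / eps) v; for s >= 0, by the
    symmetry of the corner, F - g is a switched remainder plus eps c0 (- s / eps) v.
    Where the switch is active, u = c2 (s / eps) is at least m, so that the O(1) terms
    coming from the remainder are O(u); elsewhere they vanish.  The corner terms are
    bounded by u because of [corner_chain]. *)
Lemma blend_estimates c0 c1 c2 c3 m K (cc : convex_corner c0 c1 c2 c3 m K) (M : R) :
  0 < M -> exists C, 0 < C /\
  forall e f g, controlled e M f -> controlled e M g -> f 0 = g 0 ->
  forall eps s, 0 < eps < e -> eps <= 1 -> Rabs s <= eps ->
  let v := Derive g 0 - Derive f 0 in
  let F := blend c0 c1 eps f g in
  let t := / eps * s in
  (s <= 0 -> bent_close C eps (c2 t) v F f s) /\
  (0 <= s -> bent_close C eps (c2 t) v F g s) /\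
  Rabs (F s - f 0) <= C * eps /\
  Rabs (Derive F s - (Derive f 0 + c1 t * v)) <= C * eps.
Proof.
  intro hM.
  assert (hm := corner_positive _ _ _ _ _ _ cc).
  assert (hK : 0 <= K).
  { eapply Rle_trans; [apply Rabs_pos|]. apply (corner_bound _ _ _ _ _ _ cc 0). }
  set (B := 8 * K * (2 * M) + 2 * M).
  assert (hB : 0 < B) by (unfold B; nra).
  assert (hmB : 0 < B / m) by (apply Rdiv_lt_0_compat; assumption).
  exists (B / m + 2 * M + B + 4 * M + M). split; [lra|].
  set (C := B / m + 2 * M + B + 4 * M + M).
  intros e f g hf hg hfg eps s he he1 hs v F t.
  destruct hf as [sf bf]. destruct hg as [sg bg].
  assert (hse : Rabs s < e) by lra.
  destruct (is_derive_blend _ _ _ _ _ _ cc eps e f g ltac:(lra) sf sg s hse) as [D1 D2].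
  fold F in D1, D2. fold v in D1, D2. fold t in D1, D2.
  destruct (bf s hse) as [f1 [f2 [f3 f4]]]. destruct (bg s hse) as [g1 [g2 [g3 g4]]].
  assert (hs2 : s ^ 2 <= eps ^ 2).
  { rewrite <- (pow2_abs s). apply pow_incr. split; [apply Rabs_pos|exact hs]. }
  assert (fl := controlled_lipschitz e M f s (conj sf bf) hse).
  assert (hMs : M * Rabs s <= M * eps) by (apply Rmult_le_compat_l; lra).
  assert (hMs2 : M * s ^ 2 <= M * eps ^ 2) by (apply Rmult_le_compat_l; lra).
  assert (hv : Rabs v <= 2 * M).
  { unfold v, Rminus. eapply Rle_trans; [apply Rabs_triang|]. rewrite Rabs_Ropp.
    assert (h0 : Rabs 0 < e) by (rewrite Rabs_R0; lra).
    generalize (proj1 (bf 0 h0)), (proj1 (bg 0 h0)). lra. }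
  set (E := g s - f s - s * v). set (E' := Derive g s - Derive f s - v).
  set (E'' := Derive (Derive g) s - Derive (Derive f) s).
  assert (bE : Rabs E <= 2 * M * eps ^ 2).
  { unfold E, v. replace (g s - f s - s * (Derive g 0 - Derive f 0))
      with ((g s - g 0 - s * Derive g 0) + - (f s - f 0 - s * Derive f 0)) by (rewrite hfg; ring).
    eapply Rle_trans; [apply Rabs_triang|]. rewrite Rabs_Ropp. lra. }
  assert (bE' : Rabs E' <= 2 * M * eps).
  { unfold E', v. replace (Derive g s - Derive f s - (Derive g 0 - Derive f 0))
      with ((Derive g s - Derive g 0) + - (Derive f s - Derive f 0)) by ring.
    eapply Rle_trans; [apply Rabs_triang|]. rewrite Rabs_Ropp. lra. }
  assert (bE'' : Rabs E'' <= 2 * M).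
  { unfold E'', Rminus. eapply Rle_trans; [apply Rabs_triang|]. rewrite Rabs_Ropp. lra. }
  assert (et : eps * t = s) by (unfold t; field; lra).
  assert (e2t : 2 / eps * s = 2 * t) by (unfold t; field; lra).
  assert (ht : -1 <= t <= 1).
  { apply Rabs_le_between in hs. split; apply (Rmult_le_reg_l eps); lra. }
  assert (F0 : F s = f s + c1 (2 * t) * E + eps * c0 t * v).
  { unfold F, blend. fold v. fold E. rewrite e2t. reflexivity. }
  rewrite e2t in D1, D2. fold E in D1, D2. fold E' in D1, D2. fold E'' in D2.
  assert (bnd := corner_bound _ _ _ _ _ _ cc). assert (slo := corner_slope _ _ _ _ _ _ cc).
  assert (sw := fun (b : R) (hb : Rabs b <= 1) =>
    switch_terms_bound K (2 * M) eps b (c2 (2 * t)) (c3 (2 * t)) E E' E''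
      hK ltac:(lra) ltac:(lra) hb (proj1 (bnd _)) (proj2 (bnd _)) bE bE' bE'').
  cbv zeta in sw. fold B in sw.
  assert (b1 : Rabs (c1 (2 * t)) <= 1) by (apply Rabs_le; generalize (slo (2 * t)); lra).
  assert (mid : forall u, m <= u -> B <= B / m * u).
  { intros u hu. replace B with (B / m * m) at 1 by (field; lra). apply Rmult_le_compat_l; lra. }
  assert (small : B * eps <= B) by nra.
  (* Z, Z', Z'' stand for the switched remainder and its derivatives, w and w' for the
     corner term and its slope *)
  assert (close : forall u w w' Z Z' Z'', 0 <= w <= u -> -u <= w' <= u ->
     Rabs Z <= B / m * u -> Rabs Z' <= B / m * u -> Rabs Z'' <= B / m * u ->
     Rabs (Z + eps * w * v) <= C * u /\ Rabs (Z' + w' * v) <= C * u /\ Rabs Z'' <= C * u).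
  { intros u w w' Z Z' Z'' hw hw' hZ hZ' hZ''.
    assert (k1 : Rabs (eps * w * v) <= u * (2 * M)).
    { apply Rabs_mult_le; [|exact hv]. rewrite Rabs_pos_eq by nra. nra. }
    assert (k2 : Rabs (w' * v) <= u * (2 * M)).
    { apply Rabs_mult_le; [|exact hv]. apply Rabs_le. lra. }
    assert (B * u >= 0) by nra. assert (M * u >= 0) by nra.
    unfold C. repeat split; try lra;
      (eapply Rle_trans; [apply Rabs_triang|lra]). }
  split; [|split; [|split]].
  - intro s0. assert (t0 : t <= 0) by (apply (Rmult_le_reg_l eps); lra).
    destruct (corner_chain _ _ _ _ _ _ cc t t0) as [h0 h1].
    unfold bent_close.
    replace (F s - f s) with (c1 (2 * t) * E + eps * c0 t * v) by (rewrite F0; ring).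
    replace (Derive F s - Derive f s) with
      ((2 / eps * c2 (2 * t) * E + c1 (2 * t) * E') + c1 t * v) by (rewrite D1; ring).
    replace (Derive (Derive F) s - Derive (Derive f) s - c2 t / eps * v) with
      (4 / eps ^ 2 * c3 (2 * t) * E + 2 * (2 / eps * c2 (2 * t)) * E' + c1 (2 * t) * E'')
      by (rewrite D2; ring).
    destruct (Rle_dec (-1/2) t) as [h|h].
    + destruct (sw _ b1) as [z0 [z1 z2]].
      assert (hu := mid _ (corner_bend _ _ _ _ _ _ cc t ltac:(lra))).
      apply close; lra.
    + destruct (corner_left _ _ _ _ _ _ cc (2 * t) ltac:(lra)) as [_ [q1 q2]].
      rewrite q1, q2, (corner_flat_outside _ _ _ _ _ _ cc (2 * t)) by lra.
      assert (0 <= B / m * c2 t) by (apply Rmult_le_pos; lra).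
      apply close; rewrite ?Rmult_0_r, ?Rmult_0_l, ?Rplus_0_r, ?Rmult_0_l, ?Rplus_0_r, ?Rabs_R0; lra.
  - intro s0. assert (t0 : 0 <= t) by (apply (Rmult_le_reg_l eps); lra).
    destruct (corner_chain _ _ _ _ _ _ cc (- t) ltac:(lra)) as [h0 h1].
    rewrite (corner_bend_even _ _ _ _ _ _ cc) in h1.
    generalize (corner_symmetric _ _ _ _ _ _ cc t), (corner_slope_symmetric _ _ _ _ _ _ cc t);
      intros y0 y1.
    unfold bent_close.
    replace (F s - g s) with ((c1 (2 * t) - 1) * E + eps * c0 (- t) * v).
    2: { rewrite F0. replace (c0 (- t)) with (c0 t - t) by lra. unfold E. rewrite <- et. ring. }
    replace (Derive F s - Derive g s) with
      ((2 / eps * c2 (2 * t) * E + (c1 (2 * t) - 1) * E') + - c1 (- t) * v).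
    2: { rewrite D1. replace (c1 (- t)) with (1 - c1 t) by lra. unfold E'. ring. }
    replace (Derive (Derive F) s - Derive (Derive g) s - c2 t / eps * v) with
      (4 / eps ^ 2 * c3 (2 * t) * E + 2 * (2 / eps * c2 (2 * t)) * E' + (c1 (2 * t) - 1) * E'')
      by (rewrite D2; unfold E''; ring).
    destruct (Rle_dec t (1/2)) as [h|h].
    + destruct (sw (c1 (2 * t) - 1)) as [z0 [z1 z2]].
      { apply Rabs_le; generalize (slo (2 * t)); lra. }
      assert (hu := mid _ (corner_bend _ _ _ _ _ _ cc t ltac:(lra))).
      apply close; lra.
    + destruct (corner_right _ _ _ _ _ _ cc (2 * t) ltac:(lra)) as [_ [q1 q2]].
      rewrite q1, q2, (corner_flat_outside _ _ _ _ _ _ cc (2 * t)) by lra.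
      assert (0 <= B / m * c2 t) by (apply Rmult_le_pos; lra).
      replace (1 - 1) with 0 by ring.
      apply close; rewrite ?Rmult_0_r, ?Rmult_0_l, ?Rplus_0_r, ?Rmult_0_l, ?Rplus_0_r, ?Rabs_R0; lra.
  - destruct (sw _ b1) as [z0 _].
    assert (w : Rabs (c0 t) <= 2).
    { generalize (slo t), (slo (- t)); intros y1 y2.
      destruct (Rle_dec t 0) as [h|h].
      - destruct (corner_chain _ _ _ _ _ _ cc t h) as [h0 h1]. apply Rabs_le. lra.
      - destruct (corner_chain _ _ _ _ _ _ cc (- t) ltac:(lra)) as [h0 h1].
        generalize (corner_symmetric _ _ _ _ _ _ cc t). intro. apply Rabs_le. lra. }
    assert (k := Rabs_mult_le _ _ _ _ w hv).
    replace (F s - f 0) with ((f s - f 0) + c1 (2 * t) * E + (c0 t * v) * eps) by (rewrite F0; ring).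
    eapply Rle_trans; [apply Rabs_triang|].
    eapply Rle_trans; [apply Rplus_le_compat_r, Rabs_triang|].
    rewrite (Rabs_mult (c0 t * v)), (Rabs_pos_eq eps) by lra.
    assert (Rabs (c0 t * v) * eps <= 2 * (2 * M) * eps) by (apply Rmult_le_compat_r; lra).
    unfold C. nra.
  - destruct (sw _ b1) as [_ [z1 _]].
    replace (Derive F s - (Derive f 0 + c1 t * v)) with
      ((Derive f s - Derive f 0) + (2 / eps * c2 (2 * t) * E + c1 (2 * t) * E'))
      by (rewrite D1; ring).
    eapply Rle_trans; [apply Rabs_triang|]. unfold C. nra.
Qed.

(** * Geometry of the two branches *)

Lemma increasing_of_derivative (f f' : R -> R) (a b : R) :
  a < b -> (forall t, a <= t <= b -> is_derive f t (f' t) /\ 0 < f' t) -> f a < f b.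
Proof.
  intros hab h. destruct (mean_value f f' a b ltac:(lra)) as [c [hc e]].
  - intros t ht. apply h, ht.
  - destruct (h c hc) as [_ h0]. nra.
Qed.

Lemma dist2_le (p q : plane) (a b : R) :
  Rabs (x3 p - x3 q) <= a -> Rabs (x1 p - x1 q) <= b -> dist2 p q <= a + b.
Proof.
  intros ha hb. unfold dist2, dist_euc.
  assert (0 <= a) by (eapply Rle_trans; [apply Rabs_pos|exact ha]).
  assert (0 <= b) by (eapply Rle_trans; [apply Rabs_pos|exact hb]).
  rewrite <- (sqrt_pow2 (a + b)) by lra. apply sqrt_le_1_alt.
  assert (Rsqr (x3 p - x3 q) <= a ^ 2).
  { rewrite Rsqr_abs. unfold Rsqr. generalize (Rabs_pos (x3 p - x3 q)). nra. }
  assert (Rsqr (x1 p - x1 q) <= b ^ 2).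
  { rewrite Rsqr_abs. unfold Rsqr. generalize (Rabs_pos (x1 p - x1 q)). nra. }
  nra.
Qed.

Lemma velocity_nonzero (r : R -> plane) (s a b : R) :
  0 < x3 (velocity r s) * a + x1 (velocity r s) * b -> velocity r s <> (0, 0).
Proof.
  intros h e. rewrite e in h. unfold x3, x1 in h; simpl in h. lra.
Qed.

Lemma unit_speed_near (D : R -> Prop) (r : R -> plane) :
  locally 0 D -> smooth_regular D r -> unit_speed D r ->
  exists e M, 0 < e /\ 0 < M /\
    controlled e M (fun t => x3 (r t)) /\ controlled e M (fun t => x1 (r t)) /\
    forall t, Rabs t < e -> locally t D /\
      x3 (velocity r t) * x3 (velocity r t) + x1 (velocity r t) * x1 (velocity r t) = 1.
Proof.
  intros h0 hr hu.
  destruct (hr 0 (locally_singleton _ _ h0)) as [g [hg _]].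
  assert (hs : locally 0 (fun t => smooth_at r t)).
  { assert (h : locally 0 (fun t => smooth_at g t /\ g t = r t)).
    { generalize (filter_and _ _ h0 hg). apply filter_imp. intros t [hD [h1 h2]].
      split; [exact h1|symmetry; exact (h2 hD)]. }
    apply locally_locally in h. revert h. apply filter_imp. intros t ht n.
    destruct (locally_singleton _ _ ht) as [h1 _].
    split.
    - apply (ex_derive_n_ext_loc (fun u => x3 (g u))); [|apply h1].
      revert ht. apply filter_imp. intros u [_ e]. rewrite e. reflexivity.
    - apply (ex_derive_n_ext_loc (fun u => x1 (g u))); [|apply h1].
      revert ht. apply filter_imp. intros u [_ e]. rewrite e. reflexivity. }
  destruct (controlled_near (fun t => x3 (r t))) as [e3 [M3 [he3 [hM3 k3]]]].
  { revert hs. apply filter_imp. intros t ht n. apply ht. }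
  destruct (controlled_near (fun t => x1 (r t))) as [e1 [M1 [he1 [hM1 k1]]]].
  { revert hs. apply filter_imp. intros t ht n. apply ht. }
  apply locally_locally in h0. destruct h0 as [d hd].
  generalize (Rmin_l (Rmin e3 e1) d), (Rmin_r (Rmin e3 e1) d), (Rmin_l e3 e1), (Rmin_r e3 e1),
    (Rmax_l M3 M1), (Rmax_r M3 M1); intros m1 m2 m3 m4 m5 m6.
  exists (Rmin (Rmin e3 e1) d), (Rmax M3 M1).
  split; [repeat apply Rmin_glb_lt; try assumption; apply cond_pos|].
  split; [lra|].
  split; [apply (controlled_weaken e3 _ M3); try assumption; lra|].
  split; [apply (controlled_weaken e1 _ M1); try assumption; lra|].
  intros t ht.
  assert (hl : locally t D).
  { apply hd. unfold ball; simpl. unfold AbsRing_ball, abs, minus, plus, opp; simpl.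
    rewrite Ropp_0, Rplus_0_r. lra. }
  split; [exact hl|]. generalize (hu t hl). unfold speed, dot. intro q.
  set (S := x3 (velocity r t) * x3 (velocity r t) + x1 (velocity r t) * x1 (velocity r t)) in *.
  assert (hS : 0 <= S).
  { unfold S. apply Rplus_le_le_0_compat; apply Rle_0_sqr. }
  rewrite <- (pow2_sqrt S hS), q. ring.
Qed.

(** The sine and cosine of the turning angle have squares adding up to 1. *)
Lemma turn_less_than_pi (a3 a1 b3 b1 : R) :
  a3 * a3 + a1 * a1 = 1 -> b3 * b3 + b1 * b1 = 1 -> 0 < b3 * a1 - b1 * a3 ->
  0 < 1 + (a3 * b3 + a1 * b1).
Proof.
  intros ha hb h.
  assert ((b3 * a1 - b1 * a3) ^ 2 + (a3 * b3 + a1 * b1) ^ 2 = 1).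
  { replace 1 with ((a3 * a3 + a1 * a1) * (b3 * b3 + b1 * b1)) by (rewrite ha, hb; ring). ring. }
  nra.
Qed.

Lemma unit_components (a3 a1 : R) :
  a3 * a3 + a1 * a1 = 1 -> -1 <= a3 <= 1 /\ -1 <= a1 <= 1.
Proof. intro h. nra. Qed.

(** On the segment between the unit vectors a and b the component along a + b and the
    determinant with b - a are constant; a deviation eta in each coordinate changes
    them by at most 4 eta, since the coordinates of a + b and b - a are at most 2 in size. *)
Lemma between_directions (a3 a1 b3 b1 l eta P3 P1 : R) :
  a3 * a3 + a1 * a1 = 1 -> b3 * b3 + b1 * b1 = 1 -> 0 <= l <= 1 -> 0 <= eta ->
  Rabs (P3 - (a3 + l * (b3 - a3))) <= eta -> Rabs (P1 - (a1 + l * (b1 - a1))) <= eta ->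
  1 + (a3 * b3 + a1 * b1) - 4 * eta <= P3 * (a3 + b3) + P1 * (a1 + b1) /\
  b3 * a1 - b1 * a3 - 4 * eta <= (b3 - a3) * P1 - (b1 - a1) * P3 /\
  Rabs P3 <= 1 + eta /\ Rabs P1 <= 1 + eta.
Proof.
  intros ha hb hl heta h3 h1.
  destruct (unit_components _ _ ha) as [ra3 ra1]. destruct (unit_components _ _ hb) as [rb3 rb1].
  set (d3 := P3 - (a3 + l * (b3 - a3))) in *. set (d1 := P1 - (a1 + l * (b1 - a1))) in *.
  assert (e3 : P3 = a3 + l * (b3 - a3) + d3) by (unfold d3; ring).
  assert (e1 : P1 = a1 + l * (b1 - a1) + d1) by (unfold d1; ring).
  assert (w3 : Rabs (a3 + b3) <= 2) by (apply Rabs_le; lra).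
  assert (w1 : Rabs (a1 + b1) <= 2) by (apply Rabs_le; lra).
  assert (v3 : Rabs (b3 - a3) <= 2) by (apply Rabs_le; lra).
  assert (v1 : Rabs (b1 - a1) <= 2) by (apply Rabs_le; lra).
  assert (k1 := Rabs_mult_le _ _ _ _ h3 w3). assert (k2 := Rabs_mult_le _ _ _ _ h1 w1).
  assert (k3 := Rabs_mult_le _ _ _ _ v3 h1). assert (k4 := Rabs_mult_le _ _ _ _ v1 h3).
  apply Rabs_le_between in k1. apply Rabs_le_between in k2.
  apply Rabs_le_between in k3. apply Rabs_le_between in k4.
  rewrite e3, e1. split; [|split; [|split]].
  - replace ((a3 + l * (b3 - a3) + d3) * (a3 + b3) + (a1 + l * (b1 - a1) + d1) * (a1 + b1))
      with ((1 - l) * (a3 * a3 + a1 * a1) + l * (b3 * b3 + b1 * b1) + (a3 * b3 + a1 * b1)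
            + (d3 * (a3 + b3) + d1 * (a1 + b1))) by ring.
    rewrite ha, hb. lra.
  - replace ((b3 - a3) * (a1 + l * (b1 - a1) + d1) - (b1 - a1) * (a3 + l * (b3 - a3) + d3))
      with (b3 * a1 - b1 * a3 + ((b3 - a3) * d1 - (b1 - a1) * d3)) by ring.
    lra.
  - eapply Rle_trans; [apply Rabs_triang|]. apply Rplus_le_compat; [|exact h3].
    apply Rabs_le. nra.
  - eapply Rle_trans; [apply Rabs_triang|]. apply Rplus_le_compat; [|exact h1].
    apply Rabs_le. nra.
Qed.

(** Cauchy-Schwarz, together with |a + b| <= 2. *)
Lemma norm_lower_bound (k a3 a1 b3 b1 P3 P1 : R) :
  a3 * a3 + a1 * a1 = 1 -> b3 * b3 + b1 * b1 = 1 -> 0 <= k ->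
  k <= P3 * (a3 + b3) + P1 * (a1 + b1) -> k ^ 2 / 4 <= P3 * P3 + P1 * P1.
Proof.
  intros ha hb hk h.
  assert (hw : (a3 + b3) ^ 2 + (a1 + b1) ^ 2 <= 4).
  { assert (0 <= (a3 - b3) ^ 2 + (a1 - b1) ^ 2)
      by (apply Rplus_le_le_0_compat; apply pow2_ge_0). nra. }
  assert (hcs : (P3 * (a3 + b3) + P1 * (a1 + b1)) ^ 2
    <= (P3 * P3 + P1 * P1) * ((a3 + b3) ^ 2 + (a1 + b1) ^ 2)).
  { assert (0 <= (P3 * (a1 + b1) - P1 * (a3 + b3)) ^ 2) by apply pow2_ge_0. nra. }
  assert (k ^ 2 <= (P3 * (a3 + b3) + P1 * (a1 + b1)) ^ 2) by (apply pow_incr; lra).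
  assert (0 <= P3 * P3 + P1 * P1) by (apply Rplus_le_le_0_compat; apply Rle_0_sqr).
  nra.
Qed.

Lemma controlled_velocity (e M : R) (f : R -> R) (t : R) :
  controlled e M f -> Rabs t < e -> Rabs (Derive f t - Derive f 0) <= M * Rabs t.
Proof. intros [_ h] ht. apply (h t ht). Qed.

(** Used to show injectivity: a curve whose velocity has positive component along a fixed
    direction cannot come back. *)
Lemma increasing_along (e w3 w1 : R) (f3 f1 : R -> R) :
  smooth_on (fun t => Rabs t < e) f3 -> smooth_on (fun t => Rabs t < e) f1 ->
  forall a b, a < b -> -e < a -> b < e ->
  (forall t, a <= t <= b -> 0 < Derive f3 t * w3 + Derive f1 t * w1) ->
  f3 a * w3 + f1 a * w1 < f3 b * w3 + f1 b * w1.
Proof.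
  intros h3 h1 a b hab ha hb h.
  apply (increasing_of_derivative (fun t => f3 t * w3 + f1 t * w1)
           (fun t => Derive f3 t * w3 + Derive f1 t * w1) a b hab).
  intros t ht. split; [|apply h, ht].
  assert (he : Rabs t < e) by (apply Rabs_def1; lra).
  assert (ex_derive f3 t) by apply (h3 1%nat t he).
  assert (ex_derive f1 t) by apply (h1 1%nat t he).
  auto_derive; [repeat split; assumption|].
  change (fun x => f3 x) with f3. change (fun x => f1 x) with f1. ring.
Qed.

(** * The smoothed curve *)

Definition blend_curves (c0 c1 : R -> R) (eps : R) (r1 r2 : R -> plane) (s : R) : plane :=
  (blend c0 c1 eps (fun t => x3 (r1 t)) (fun t => x3 (r2 t)) s,
   blend c0 c1 eps (fun t => x1 (r1 t)) (fun t => x1 (r2 t)) s).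

Lemma mean_curvature_le_of_bent_close (M C c y0 V3 V1 : R) :
  0 < M -> 0 < C -> 0 < c -> 0 < y0 ->
  exists e0, 0 < e0 /\
  forall eps u (q r : R -> plane) s h,
  0 < eps < e0 -> 0 <= u ->
  x3 (velocity q s) * x3 (velocity q s) + x1 (velocity q s) * x1 (velocity q s) = 1 ->
  Rabs (Derive (Derive (fun t => x3 (q t))) s) <= M ->
  Rabs (Derive (Derive (fun t => x1 (q t))) s) <= M ->
  y0 <= x1 (q s) -> y0 <= x1 (r s) ->
  bent_close C eps u V3 (fun t => x3 (r t)) (fun t => x3 (q t)) s ->
  bent_close C eps u V1 (fun t => x1 (r t)) (fun t => x1 (q t)) s ->
  Rabs (x3 (velocity r s)) <= M -> Rabs (x1 (velocity r s)) <= M ->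
  c <= x3 (velocity r s) * x3 (velocity r s) + x1 (velocity r s) * x1 (velocity r s) ->
  c <= V3 * x1 (velocity r s) - V1 * x3 (velocity r s) ->
  is_revolution_mean_curvature q s h -> h <= profile_mean_curvature r s.
Proof.
  intros hM hC hc hy.
  destruct (mean_curvature_increases M C c y0 hM hC hc hy) as [e0 [he0 H]].
  exists e0. split; [exact he0|].
  intros eps u q r s h he hu hq k3 k1 yq yr [_ [d3 dd3]] [d0 [d1 dd1]] b3 b1 hn ht hh.
  apply is_revolution_mean_curvature_iff in hh.
  - rewrite hh. eapply (H eps u); try eassumption.
  - intro e. rewrite e in hq. unfold x3, x1 in hq; simpl in hq. lra.
  - lra.
Qed.

Theorem theorem4p1
  (D1 D2 : R -> Prop) (r1 r2 : R -> plane) (p : plane) (H1 H2 : R -> R)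
  (int1 : is_interval D1) (int2 : is_interval D2)
  (zero1 : locally 0 D1) (zero2 : locally 0 D2)
  (reg1 : smooth_regular D1 r1) (reg2 : smooth_regular D2 r2)
  (arc1 : unit_speed D1 r1) (arc2 : unit_speed D2 r2)
  (simple1 : simple_curve D1 r1) (simple2 : simple_curve D2 r2)
  (half1 : forall s, D1 s -> 0 < x1 (r1 s))
  (half2 : forall s, D2 s -> 0 < x1 (r2 s))
  (p1 : p = r1 0) (p2 : p = r2 0)
  (transverse : det2 (tangent r1 0) (tangent r2 0) <> 0)
  (only_p : forall s t, D1 s -> D2 t -> r1 s = r2 t -> r1 s = p)
  (turn : 0 < dot (tangent r2 0) (normal r1 0))
  (mean1 : forall s, locally s D1 -> is_revolution_mean_curvature r1 s (H1 s))
  (mean2 : forall s, locally s D2 -> is_revolution_mean_curvature r2 s (H2 s)) :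
  forall delta : R, 0 < delta ->
  exists (eps : R) (r : R -> plane) (H : R -> R),
    0 < eps /\
    (forall s, - eps <= s <= eps -> locally s D1 /\ locally s D2) /\
    smooth_regular (joined D1 D2) r /\
    (forall s, D1 s -> s <= - eps -> r s = r1 s) /\
    (forall s, D2 s -> eps <= s -> r s = r2 s) /\
    injective_on (fun s => - eps <= s <= eps) r /\
    (forall s t, - eps <= s <= eps -> joined D1 D2 t -> eps < Rabs t ->
       dist2 (r t) p < delta -> r s <> r t) /\
    (forall s, - eps <= s <= eps -> dist2 (r s) p < delta) /\
    (forall s, joined D1 D2 s -> 0 < x1 (r s)) /\
    (forall s, locally s (joined D1 D2) ->
       is_revolution_mean_curvature r s (H s)) /\
    (forall s, - eps < s < 0 -> H1 s <= H s) /\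
    (forall s, 0 < s < eps -> H2 s <= H s).
Proof.
  intros delta hdelta.
  destruct (unit_speed_near D1 r1 zero1 reg1 arc1) as [ea [Ma [hea [hMa [ca3 [ca1 ua]]]]]].
  destruct (unit_speed_near D2 r2 zero2 reg2 arc2) as [eb [Mb [heb [hMb [cb3 [cb1 ub]]]]]].
  set (M := Rmax Ma Mb).
  assert (hM1 := Rmax_l Ma Mb). assert (hM2 := Rmax_r Ma Mb). fold M in hM1, hM2.
  assert (hM : 0 < M) by lra.
  set (a3 := x3 (velocity r1 0)). set (a1 := x1 (velocity r1 0)).
  set (b3 := x3 (velocity r2 0)). set (b1 := x1 (velocity r2 0)).
  assert (hz1 : Rabs 0 < ea) by (rewrite Rabs_R0; lra).
  assert (hz2 : Rabs 0 < eb) by (rewrite Rabs_R0; lra).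
  assert (ha := proj2 (ua 0 hz1)). assert (hb := proj2 (ub 0 hz2)).
  fold a3 a1 in ha. fold b3 b1 in hb.
  (* tau is the sine of the turning angle, kappa is 1 plus its cosine *)
  set (tau := b3 * a1 - b1 * a3).
  assert (htau : 0 < tau).
  { assert (s1 := arc1 0 zero1). assert (s2 := arc2 0 zero2).
    change (0 < b3 / speed r2 0 * (a1 / speed r1 0) + b1 / speed r2 0 * - (a3 / speed r1 0))
      in turn.
    rewrite s1, s2 in turn. unfold tau. lra. }
  set (kappa := 1 + (a3 * b3 + a1 * b1)).
  assert (hkappa : 0 < kappa) by (apply turn_less_than_pi; assumption).
  set (y0 := x1 p / 2).
  assert (hy0 : 0 < y0).
  { unfold y0. generalize (half1 0 (locally_singleton _ _ zero1)). rewrite <- p1. lra. }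
  (* within e of the parameter 0 both velocities, which vary by at most M e, keep a
     positive component along T1 + T2 *)
  set (e := Rmin (Rmin ea eb) (kappa / (8 * M))).
  assert (he : 0 < e).
  { unfold e. repeat apply Rmin_glb_lt; try assumption. apply Rdiv_lt_0_compat; lra. }
  assert (hee : e <= ea /\ e <= eb /\ 8 * M * e <= kappa).
  { generalize (Rmin_l (Rmin ea eb) (kappa / (8 * M))), (Rmin_r (Rmin ea eb) (kappa / (8 * M))),
      (Rmin_l ea eb), (Rmin_r ea eb). fold e. intros m1 m2 m3 m4. repeat split; try lra.
    apply (Rmult_le_compat_l (8 * M)) in m2; [|lra].
    replace (8 * M * (kappa / (8 * M))) with kappa in m2 by (field; lra). exact m2. }
  destruct hee as [hea' [heb' hek]].
  apply (controlled_weaken ea e Ma M) in ca3; [|assumption|assumption].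
  apply (controlled_weaken ea e Ma M) in ca1; [|assumption|assumption].
  apply (controlled_weaken eb e Mb M) in cb3; [|assumption|assumption].
  apply (controlled_weaken eb e Mb M) in cb1; [|assumption|assumption].
  destruct convex_corner_exists as [c0 [c1 [c2 [c3 [m [K cc]]]]]].
  destruct (blend_estimates _ _ _ _ _ _ cc M hM) as [C [hC est]].
  (* beyond the parameter distance e the branches stay at distance d1, d2 from p; this
     is fixed before eps, so the short transition arc cannot meet them there *)
  destruct simple1 as [_ far1]. destruct simple2 as [_ far2].
  destruct (far1 0 (locally_singleton _ _ zero1) e he) as [d1 [hd1 near1]].
  destruct (far2 0 (locally_singleton _ _ zero2) e he) as [d2 [hd2 near2]].
  (* the velocity of the transition arc has component at least kappa / 2 along T1 + T2,
     hence squared length at least kappa^2 / 16 *)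
  set (c := Rmin (tau / 2) (kappa ^ 2 / 16)).
  assert (hc : 0 < c).
  { apply Rmin_glb_lt; [lra|]. assert (0 < kappa ^ 2) by (apply pow_lt, hkappa). lra. }
  destruct (mean_curvature_le_of_bent_close (M + 2) C c y0 (b3 - a3) (b1 - a1)
              ltac:(lra) hC hc hy0) as [e0 [he0 compare]].
  (* th is below all thresholds; the choice of eps makes C eps, M eps and eps small
     compared with it *)
  set (th := Rmin (Rmin (Rmin 1 kappa) (Rmin tau y0)) (Rmin delta (Rmin d1 d2))).
  assert (hth : 0 < th) by (unfold th; repeat apply Rmin_glb_lt; lra).
  assert (hth' : th <= 1 /\ th <= kappa /\ th <= tau /\ th <= y0 /\ th <= delta /\ th <= d1 /\ th <= d2).
  { unfold th. repeat split; unfold Rmin; repeat destruct Rle_dec; lra. }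
  destruct hth' as [t1 [t2 [t3 [t4 [t5 [t6 t7]]]]]].
  set (eps := Rmin (Rmin (e / 2) (e0 / 2)) (th / (8 * C + M + 8))).
  assert (heps : 0 < eps).
  { unfold eps. repeat apply Rmin_glb_lt; try lra. apply Rdiv_lt_0_compat; lra. }
  assert (heps' : eps < e /\ eps < e0 /\ (8 * C + M + 8) * eps <= th).
  { generalize (Rmin_l (Rmin (e / 2) (e0 / 2)) (th / (8 * C + M + 8))),
      (Rmin_r (Rmin (e / 2) (e0 / 2)) (th / (8 * C + M + 8))),
      (Rmin_l (e / 2) (e0 / 2)), (Rmin_r (e / 2) (e0 / 2)). fold eps. intros m1 m2 m3 m4.
    repeat split; try lra.
    apply (Rmult_le_compat_l (8 * C + M + 8)) in m2; [|lra].
    replace ((8 * C + M + 8) * (th / (8 * C + M + 8))) with th in m2 by (field; lra). exact m2. }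
  destruct heps' as [epse [epse0 epsth]].
  assert (hCe : 0 < C * eps) by (apply Rmult_lt_0_compat; assumption).
  assert (hMe : 0 < M * eps) by (apply Rmult_lt_0_compat; assumption).
  assert (heps1 : eps <= 1) by lra.
  assert (z3 : x3 (r1 0) = x3 (r2 0)) by (rewrite <- p1, <- p2; reflexivity).
  assert (z1 : x1 (r1 0) = x1 (r2 0)) by (rewrite <- p1, <- p2; reflexivity).
  set (r := blend_curves c0 c1 eps r1 r2).
  assert (est3 := fun s => est e _ _ ca3 cb3 z3 eps s (conj heps epse) heps1).
  assert (est1 := fun s => est e _ _ ca1 cb1 z1 eps s (conj heps epse) heps1).
  cbv zeta beta in est3, est1.
  change (Derive (fun t => x3 (r2 t)) 0) with b3 in est3.
  change (Derive (fun t => x3 (r1 t)) 0) with a3 in est3.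
  change (Derive (fun t => x1 (r2 t)) 0) with b1 in est1.
  change (Derive (fun t => x1 (r1 t)) 0) with a1 in est1.
  set (F3 := fun t => x3 (r t)). set (F1 := fun t => x1 (r t)).
  change (blend c0 c1 eps (fun t => x3 (r1 t)) (fun t => x3 (r2 t))) with F3 in est3.
  change (blend c0 c1 eps (fun t => x1 (r1 t)) (fun t => x1 (r2 t))) with F1 in est1.
  rewrite <- p1 in est3, est1.
  assert (sF3 : smooth_on (fun t => Rabs t < e) F3).
  { apply (smooth_on_blend _ _ _ _ _ _ cc eps e); [apply ca3|apply cb3]. }
  assert (sF1 : smooth_on (fun t => Rabs t < e) F1).
  { apply (smooth_on_blend _ _ _ _ _ _ cc eps e); [apply ca1|apply cb1]. }
  assert (abs : forall s, - eps <= s <= eps -> Rabs s <= eps) by (intros s hs; apply Rabs_le, hs).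
  assert (dir : forall s, - eps <= s <= eps ->
    kappa / 2 <= Derive F3 s * (a3 + b3) + Derive F1 s * (a1 + b1) /\
    tau / 2 <= (b3 - a3) * Derive F1 s - (b1 - a1) * Derive F3 s /\
    Rabs (Derive F3 s) <= 2 /\ Rabs (Derive F1 s) <= 2).
  { intros s hs. destruct (est3 s (abs s hs)) as [_ [_ [_ q3]]].
    destruct (est1 s (abs s hs)) as [_ [_ [_ q1]]].
    destruct (between_directions a3 a1 b3 b1 (c1 (/ eps * s)) (C * eps) _ _ ha hb
      (corner_slope _ _ _ _ _ _ cc _) ltac:(lra) q3 q1) as [g1 [g2 [g3 g4]]].
    fold kappa in g1. fold tau in g2. repeat split; lra. }
  assert (close : forall s, - eps <= s <= eps -> dist2 (r s) p <= th / 2 /\ y0 <= x1 (r s)).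
  { intros s hs. destruct (est3 s (abs s hs)) as [_ [_ [q3 _]]].
    destruct (est1 s (abs s hs)) as [_ [_ [q1 _]]]. split.
    - eapply Rle_trans; [apply (dist2_le _ _ _ _ q3 q1)|]. lra.
    - change (x1 (r s)) with (F1 s). apply Rabs_le_between in q1.
      assert (x1 p = 2 * y0) by (unfold y0; field). lra. }
  assert (follows_r1 : forall s, s <= - eps -> r s = r1 s).
  { intros s hs. unfold r, blend_curves.
    rewrite !(blend_left _ _ _ _ _ _ cc) by assumption. symmetry. apply surjective_pairing. }
  assert (follows_r2 : forall s, eps <= s -> r s = r2 s).
  { intros s hs. unfold r, blend_curves.
    rewrite !(blend_right _ _ _ _ _ _ cc) by assumption. symmetry. apply surjective_pairing. }
  (* Phi is the component along T1 + T2; it increases along r and along both branches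
     near p, which excludes self-intersections there *)
  set (Phi := fun q : plane => x3 q * (a3 + b3) + x1 q * (a1 + b1)).
  assert (mono : forall s t, - eps <= s -> s < t -> t <= eps -> Phi (r s) < Phi (r t)).
  { intros s t hs hst ht. apply (increasing_along e _ _ F3 F1 sF3 sF1); try lra.
    intros u hu. destruct (dir u ltac:(lra)) as [g _]. lra. }
  assert (steady : forall l q3 q1, 0 <= l <= 1 -> forall t, Rabs t < e ->
     Rabs (q3 - (a3 + l * (b3 - a3))) <= M * Rabs t ->
     Rabs (q1 - (a1 + l * (b1 - a1))) <= M * Rabs t -> 0 < q3 * (a3 + b3) + q1 * (a1 + b1)).
  { intros l q3 q1 hl t ht h3 h1. assert (0 <= M * Rabs t) by (generalize (Rabs_pos t); nra).
    destruct (between_directions a3 a1 b3 b1 l (M * Rabs t) q3 q1 ha hb hl ltac:(lra) h3 h1) as [g _].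
    fold kappa in g. assert (M * Rabs t <= M * e) by (apply Rmult_le_compat_l; lra). lra. }
  assert (mono1 : forall s t, - e < s -> s < t -> t < e -> Phi (r1 s) < Phi (r1 t)).
  { intros s t hs hst ht.
    apply (increasing_along e _ _ _ _ (proj1 ca3) (proj1 ca1)); try lra.
    intros u hu. assert (hue : Rabs u < e) by (apply Rabs_def1; lra).
    apply (steady 0 _ _ ltac:(lra) u hue).
    - replace (a3 + 0 * (b3 - a3)) with a3 by ring. exact (controlled_velocity _ _ _ u ca3 hue).
    - replace (a1 + 0 * (b1 - a1)) with a1 by ring. exact (controlled_velocity _ _ _ u ca1 hue). }
  assert (mono2 : forall s t, - e < s -> s < t -> t < e -> Phi (r2 s) < Phi (r2 t)).
  { intros s t hs hst ht.
    apply (increasing_along e _ _ _ _ (proj1 cb3) (proj1 cb1)); try lra.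
    intros u hu. assert (hue : Rabs u < e) by (apply Rabs_def1; lra).
    apply (steady 1 _ _ ltac:(lra) u hue).
    - replace (a3 + 1 * (b3 - a3)) with b3 by ring. exact (controlled_velocity _ _ _ u cb3 hue).
    - replace (a1 + 1 * (b1 - a1)) with b1 by ring. exact (controlled_velocity _ _ _ u cb1 hue). }
  assert (mono' : forall s t, - eps <= s -> s <= t -> t <= eps -> Phi (r s) <= Phi (r t)).
  { intros s t hs hst ht. destruct (Req_dec s t) as [q|q]; [rewrite q; lra|].
    apply Rlt_le, mono; lra. }
  assert (smooth : smooth_regular (joined D1 D2) r).
  { intros s hs. destruct (Rlt_dec s (- eps)) as [hl|hl]; [|destruct (Rlt_dec eps s) as [hr|hr]].
    - assert (hD : D1 s) by (destruct hs as [[_ h]|[h _]]; [exact h|lra]).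
      destruct (reg1 s hD) as [g [hg hv]]. exists g. split; [|exact hv].
      generalize (filter_and _ _ (open_lt (- eps) s hl) hg). apply filter_imp.
      intros t [ht [h1 h2]]. split; [exact h1|]. intro hj. rewrite follows_r1 by lra.
      apply h2. destruct hj as [[_ h]|[h _]]; [exact h|lra].
    - assert (hD : D2 s) by (destruct hs as [[h _]|[_ h]]; [lra|exact h]).
      destruct (reg2 s hD) as [g [hg hv]]. exists g. split; [|exact hv].
      generalize (filter_and _ _ (open_gt eps s hr) hg). apply filter_imp.
      intros t [ht [h1 h2]]. split; [exact h1|]. intro hj. rewrite follows_r2 by lra.
      apply h2. destruct hj as [[h _]|[_ h]]; [lra|exact h].
    - exists r. split.
      + apply (filter_imp (fun t => Rabs t < e)).
        * intros t ht. split; [|reflexivity]. intro n. split; [apply sF3, ht|apply sF1, ht].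
        * apply open_Rabs_lt. generalize (abs s ltac:(lra)). lra.
      + apply (velocity_nonzero r s (a3 + b3) (a1 + b1)).
        destruct (dir s ltac:(lra)) as [g _].
        change (0 < Derive F3 s * (a3 + b3) + Derive F1 s * (a1 + b1)). lra. }
  assert (positive : forall s, joined D1 D2 s -> 0 < x1 (r s)).
  { intros s hs. destruct (Rlt_dec s (- eps)) as [hl|hl]; [|destruct (Rlt_dec eps s) as [hr|hr]].
    - rewrite follows_r1 by lra. apply half1. destruct hs as [[_ h]|[h _]]; [exact h|lra].
    - rewrite follows_r2 by lra. apply half2. destruct hs as [[h _]|[_ h]]; [lra|exact h].
    - destruct (close s ltac:(lra)) as [_ h]. lra. }
  assert (dominates : forall (q : R -> plane) s h, - eps <= s <= eps ->
     x3 (velocity q s) * x3 (velocity q s) + x1 (velocity q s) * x1 (velocity q s) = 1 ->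
     controlled e M (fun t => x3 (q t)) -> controlled e M (fun t => x1 (q t)) -> q 0 = p ->
     bent_close C eps (c2 (/ eps * s)) (b3 - a3) F3 (fun t => x3 (q t)) s ->
     bent_close C eps (c2 (/ eps * s)) (b1 - a1) F1 (fun t => x1 (q t)) s ->
     0 <= c2 (/ eps * s) ->
     is_revolution_mean_curvature q s h -> h <= profile_mean_curvature r s).
  { intros q s h hs hu k3 k1 hq hb3 hb1 hu0 hh.
    assert (hse := abs s hs).
    destruct (dir s hs) as [g1 [g2 [g3 g4]]]. destruct (close s hs) as [_ hy].
    apply (compare eps (c2 (/ eps * s)) q r s h); try assumption; try lra.
    - destruct (proj2 k3 s ltac:(lra)) as [_ [g _]]. lra.
    - destruct (proj2 k1 s ltac:(lra)) as [_ [g _]]. lra.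
    - assert (g := controlled_lipschitz _ _ _ s k1 ltac:(lra)). simpl in g. rewrite hq in g.
      assert (M * Rabs s <= M * eps) by (apply Rmult_le_compat_l; lra).
      apply Rabs_le_between in g. assert (x1 p = 2 * y0) by (unfold y0; field). lra.
    - change (Rabs (Derive F3 s) <= M + 2). lra.
    - change (Rabs (Derive F1 s) <= M + 2). lra.
    - change (c <= Derive F3 s * Derive F3 s + Derive F1 s * Derive F1 s).
      eapply Rle_trans; [apply Rmin_r|].
      generalize (norm_lower_bound (kappa / 2) _ _ _ _ _ _ ha hb ltac:(lra) g1). lra.
    - change (c <= (b3 - a3) * Derive F1 s - (b1 - a1) * Derive F3 s).
      eapply Rle_trans; [apply Rmin_l|]. exact g2. }
  exists eps, r, (profile_mean_curvature r).
  split; [exact heps|]. split.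
  { intros s hs. generalize (abs s hs). intro. split; [apply ua; lra|apply ub; lra]. }
  split; [exact smooth|]. split; [intros s _; apply follows_r1|]. split; [intros s _; apply follows_r2|].
  split.
  { intros s t hs ht q. destruct (Rtotal_order s t) as [h|[h|h]]; [|exact h|].
    - generalize (mono s t ltac:(lra) h ltac:(lra)). rewrite q. lra.
    - generalize (mono t s ltac:(lra) h ltac:(lra)). rewrite q. lra. }
  split.
  { intros s t hs ht hte _ q. destruct (close s hs) as [hd _].
    destruct (Rle_dec t 0) as [h|h].
    - rewrite Rabs_left1 in hte by lra.
      assert (hD : D1 t) by (destruct ht as [[_ hh]|[hh _]]; [exact hh|replace t with 0 in * by lra; lra]).
      rewrite (follows_r1 t) in q by lra.
      assert (hte' : Rabs (t - 0) < e).
      { apply near1; [exact hD|]. rewrite <- q, <- p1. unfold dist2 in *.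
        rewrite distance_symm. lra. }
      rewrite Rminus_0_r in hte'. apply Rabs_def2 in hte'.
      generalize (mono1 t (- eps) ltac:(lra) ltac:(lra) ltac:(lra)),
        (mono' (- eps) s ltac:(lra) ltac:(lra) ltac:(lra)).
      rewrite <- q, <- follows_r1 by lra. lra.
    - rewrite Rabs_pos_eq in hte by lra.
      assert (hD : D2 t) by (destruct ht as [[hh _]|[_ hh]]; [lra|exact hh]).
      rewrite (follows_r2 t) in q by lra.
      assert (hte' : Rabs (t - 0) < e).
      { apply near2; [exact hD|]. rewrite <- q, <- p2. unfold dist2 in *.
        rewrite distance_symm. lra. }
      rewrite Rminus_0_r in hte'. apply Rabs_def2 in hte'.
      generalize (mono2 eps t ltac:(lra) ltac:(lra) ltac:(lra)),
        (mono' s eps ltac:(lra) ltac:(lra) ltac:(lra)).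
      rewrite <- q, <- follows_r2 by lra. lra. }
  split; [intros s hs; destruct (close s hs); lra|].
  split; [exact positive|]. split.
  { intros s hs. assert (hj := locally_singleton _ _ hs).
    apply is_revolution_mean_curvature_iff; [| |reflexivity].
    - destruct (smooth s hj) as [g [hg hv]]. replace (velocity r s) with (velocity g s); [exact hv|].
      unfold velocity. f_equal; apply Derive_ext_loc; generalize (filter_and _ _ hs hg);
        apply filter_imp; intros t [k [_ k2]]; rewrite (k2 k); reflexivity.
    - generalize (positive s hj). lra. }
  split.
  - intros s hs. assert (hs' : - eps <= s <= eps) by lra. assert (hse := abs s hs').
    assert (ht : / eps * s <= 0).
    { apply (Rmult_le_reg_l eps); [exact heps|]. replace (eps * (/ eps * s)) with s by (field; lra). lra. }
    destruct (corner_chain _ _ _ _ _ _ cc _ ht) as [g0 g1].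
    destruct (ua s ltac:(lra)) as [hl hu].
    apply (dominates r1 s (H1 s)); try assumption; try lra.
    + symmetry; exact p1.
    + apply (est3 s hse). lra.
    + apply (est1 s hse). lra.
    + apply mean1, hl.
  - intros s hs. assert (hs' : - eps <= s <= eps) by lra. assert (hse := abs s hs').
    assert (ht : - (/ eps * s) <= 0).
    { apply (Rmult_le_reg_l eps); [exact heps|]. replace (eps * (- (/ eps * s))) with (- s) by (field; lra). lra. }
    destruct (corner_chain _ _ _ _ _ _ cc _ ht) as [g0 g1].
    rewrite (corner_bend_even _ _ _ _ _ _ cc) in g1.
    destruct (ub s ltac:(lra)) as [hl hu].
    apply (dominates r2 s (H2 s)); try assumption; try lra.
    + symmetry; exact p2.
    + apply (est3 s hse). lra.
    + apply (est1 s hse). lra.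
    + apply mean2, hl.
Qed.
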